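(* Let $d,n\geq1$ be integers and let $\boldsymbol{\lambda}\in\mathcal{P}(d,n)$ be a $d$-partition of $n$. The Schur element $s_{\boldsymbol{\lambda}}$ of the irreducible representation $V_{\boldsymbol{\lambda}}$ of $\mathbb{C}(q){\rm Y}_{d,n}(q)$ with respect to the canonical symmetrising form $\boldsymbol{\tau}$ is $$s_{\boldsymbol{\lambda}}=d^n\,q^{-2\eta(\boldsymbol{\lambda})}\prod_{\boldsymbol{\theta}\in\boldsymbol{\lambda}}[{\rm hl}(\boldsymbol{\theta})]_{q^2},$$ where, for all $h\in\mathbb{N}$, $[h]_{q^2}:=(q^{2h}-1)/(q^2-1)=q^{2(h-1)}+q^{2(h-2)}+\cdots+q^2+1$.
   Context: Let $q$ be an indeterminate. The Yokonuma--Hecke algebra ${\rm Y}_{d,n}(q)$ is the associative unital $\mathbb{C}[q,q^{-1}]$-algebra generated by $g_1,\dots,g_{n-1},t_1,\dots,t_n$ subject to: $g_ig_j=g_jg_i$ for $|i-j|>1$; $g_ig_{i+1}g_i=g_{i+1}g_ig_{i+1}$ for $i=1,\dots,n-2$; $t_it_j=t_jt_i$ for all $i,j$; $t_jg_i=g_it_{s_i(j)}$ for all $i,j$, where $s_i$ is the transposition $(i,i+1)$; $t_j^d=1$ for all $j$; and $g_i^2=1+(q-q^{-1})e_ig_i$ for all $i$, where $e_i=\frac1d\sum_{s=0}^{d-1}t_i^st_{i+1}^{-s}$. Write $\mathbb{C}(q){\rm Y}_{d,n}(q)=\mathbb{C}(q)\otimes_{\mathbb{C}[q,q^{-1}]}{\rm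 Y}_{d,n}(q)$; this algebra is split semisimple. For $w\in\mathfrak{S}_n$ with reduced expression $s_{i_1}\cdots s_{i_r}$ set $g_w:=g_{i_1}\cdots g_{i_r}$. The elements $t_1^{k_1}\cdots t_n^{k_n}g_w$ ($w\in\mathfrak{S}_n$, $k_i\in\mathbb{Z}/d\mathbb{Z}$) form a $\mathbb{C}[q,q^{-1}]$-basis, and the canonical symmetrising form $\boldsymbol{\tau}$ is the linear map with value $1$ on the basis element $1$ and $0$ on all other basis elements; it is extended linearly to $\mathbb{C}(q){\rm Y}_{d,n}(q)$. A $d$-partition of $n$ is a $d$-tuple $\boldsymbol{\lambda}=(\boldsymbol{\lambda}^{(1)},\dots,\boldsymbol{\lambda}^{(d)})$ of (possibly empty) partitions of total size $n$; $\mathcal{P}(d,n)$ is the set of all of them. A $d$-node of $\boldsymbol{\lambda}$ is a triple $\boldsymbol{\theta}=(x,y,k)$ with $(x,y)$ (row $x$, column $y$) a node of the Young diagram of $\boldsymbol{\lambda}^{(k)}$; its position is $k$, its quantum content is $q^{2(y-x)}$, and its hook length is ${\rm hl}(\boldsymbol{\theta})=\boldsymbol{\lambda}^{(k)}_x-x+\boldsymbol{\lambda}^{(k)'}_y-y+1$, where $'$ denotes the conjugate partition. For a partition $\lambda=(\lambda_1,\dots,\lambda_k)$ set $\eta(\lambda)=\sum_{i=1}^k(i-1)\lambda_i$, and $\eta(\boldsymbol{\lambda})=\sum_{i=1}^d\eta(\boldsymbol{\lambda}^{(i)})$. A $d$-tableau of shape $\boldsymbol{\lambda}$ is a bijection between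 $\{1,\dots,n\}$ and the $d$-nodes of $\boldsymbol{\lambda}$; it is standard if entries increase along rows and down columns of each diagram. For a $d$-tableau $\mathcal{T}$, $\mathrm{p}_i$ and $\mathrm{c}_i$ denote the position and quantum content of the $d$-node containing $i$, and $\mathcal{T}^{\sigma}$ is obtained by applying $\sigma\in\mathfrak{S}_n$ to the entries. Let $\{\xi_1,\dots,\xi_d\}$ be the $d$-th roots of unity in a fixed order. $V_{\boldsymbol{\lambda}}$ is the irreducible representation with $\mathbb{C}(q)$-basis $\{\mathbf{v}_{\mathcal{T}}\}$ indexed by standard $d$-tableaux of shape $\boldsymbol{\lambda}$ (with $\mathbf{v}_{\mathcal{T}}:=0$ for non-standard $\mathcal{T}$) and action $t_j(\mathbf{v}_{\mathcal{T}})=\xi_{\mathrm{p}_j}\mathbf{v}_{\mathcal{T}}$; $g_i(\mathbf{v}_{\mathcal{T}})=\mathbf{v}_{\mathcal{T}^{s_i}}$ if $\mathrm{p}_i\neq\mathrm{p}_{i+1}$; $g_i(\mathbf{v}_{\mathcal{T}})=\frac{\mathrm{c}_{i+1}(q-q^{-1})}{\mathrm{c}_{i+1}-\mathrm{c}_i}\mathbf{v}_{\mathcal{T}}+\frac{q\mathrm{c}_{i+1}-q^{-1}\mathrm{c}_i}{\mathrm{c}_{i+1}-\mathrm{c}_i}\mathbf{v}_{\mathcal{T}^{s_i}}$ if $\mathrm{p}_i=\mathrm{p}_{i+1}$. The $V_{\boldsymbol{\lambda}}$, $\boldsymbol{\lambda}\in\mathcal{P}(d,n)$, form a complete set of pairwise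 non-isomorphic irreducible representations. With $\chi_{\boldsymbol{\lambda}}$ the character of $V_{\boldsymbol{\lambda}}$, the Schur elements $s_{\boldsymbol{\lambda}}\in\mathbb{C}[q,q^{-1}]$ are the (unique) nonzero elements such that $\boldsymbol{\tau}=\sum_{\boldsymbol{\lambda}\in\mathcal{P}(d,n)}\frac{1}{s_{\boldsymbol{\lambda}}}\chi_{\boldsymbol{\lambda}}$. *)

(* Defs.v *)
From HB Require Import structures.
From mathcomp Require Import all_boot all_order all_algebra all_fingroup.
From mathcomp Require Import generic_quotient ring_quotient fraction.
From mathcomp Require Import boolp reals complex.
From mathcomp Require Import monalg.

Set Implicit Arguments.
Unset Strict Implicit.
Unset Printing Implicit Defensive.

Import GRing.Theory.

Local Open Scope ring_scope.
Local Open Scope quotient_scope.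

Section SymmetricGroup.

Variable n : nat.

(* Indices are shifted by one: for i : 'I_n.-1, the letters permuted by s_(i+1)
   are slo i and shi i, that is i and i + 1 in 'I_n. *)
Definition slo (i : 'I_n.-1) : 'I_n := widen_ord (leq_pred n) i.

Fact shi_subproof (i : 'I_n.-1) : (i.+1 < n)%N.
Proof. by rewrite -ltn_predRL. Qed.

Definition shi (i : 'I_n.-1) : 'I_n := Ordinal (shi_subproof i).

Definition simple_transp (i : 'I_n.-1) : 'S_n := tperm (slo i) (shi i).

Definition word_perm (u : seq 'I_n.-1) : 'S_n :=
  (\prod_(i <- u) simple_transp i)%g.

Definition reduced_expression (w : 'S_n) (u : seq 'I_n.-1) : Prop :=
  word_perm u = w /\ forall u', word_perm u' = w -> (size u <= size u')%N.

End SymmetricGroup.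

(* The algebra presented by the Yokonuma--Hecke generators and relations over a
   field K containing q. For K = C(q) it is the scalar extension to C(q) of the
   C[q, q^-1]-algebra given by the same presentation. *)
Section YokonumaHecke.

Variables (K : fieldType) (q : K) (d n : nat).

(* The generators g_i are the inl i, and the generators t_j the inr j. *)
Local Notation yh_gen := ('I_n.-1 + 'I_n)%type.
Local Notation yh_free := {malg K[{fmonom yh_gen}]}.

Definition free_g : 'I_n.-1 -> yh_free :=
  locked (fun i => << fmu (inl i : yh_gen) >>).
Definition free_t : 'I_n -> yh_free :=
  locked (fun j => << fmu (inr j : yh_gen) >>).

(* As t_(i+1)^d = 1 in the quotient, t_(i+1)^(-s) is written t_(i+1)^(d-s). *)
Definition free_e (i : 'I_n.-1) : yh_free :=
  (d%:R^-1 : K) *: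
    \sum_(s < d) free_t (slo i) ^+ s * free_t (shi i) ^+ (d - s).

Inductive yh_relation : yh_free -> yh_free -> Prop :=
| Rel_gg (i j : 'I_n.-1) : (i.+1 < j)%N || (j.+1 < i)%N ->
    yh_relation (free_g i * free_g j) (free_g j * free_g i)
| Rel_braid (i j : 'I_n.-1) : j = i.+1 :> nat ->
    yh_relation (free_g i * free_g j * free_g i)
                (free_g j * free_g i * free_g j)
| Rel_tt (i j : 'I_n) :
    yh_relation (free_t i * free_t j) (free_t j * free_t i)
| Rel_tg (i : 'I_n.-1) (j : 'I_n) :
    yh_relation (free_t j * free_g i) (free_g i * free_t (simple_transp i j))
| Rel_td (j : 'I_n) : yh_relation (free_t j ^+ d) 1
| Rel_gquad (i : 'I_n.-1) :
    yh_relation (free_g i ^+ 2) (1 + (q - q^-1) *: (free_e i * free_g i)).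

Inductive yh_ideal_spec : yh_free -> Prop :=
| Ideal_rel a b x y : yh_relation x y -> yh_ideal_spec (a * (x - y) * b)
| Ideal0 : yh_ideal_spec 0
| IdealD x y : yh_ideal_spec x -> yh_ideal_spec y -> yh_ideal_spec (x + y).

Definition yh_ideal : {pred yh_free} := fun x => `[< yh_ideal_spec x >].

Lemma yh_idealP x : reflect (yh_ideal_spec x) (x \in yh_ideal).
Proof. exact: asboolP. Qed.

Lemma yh_idealMl a x : x \in yh_ideal -> a * x \in yh_ideal.
Proof.
move=> /yh_idealP xI; apply/yh_idealP.
elim: xI => [b c y z r||y z _ IHy _ IHz].
- by rewrite 2!mulrA; exact: Ideal_rel.
- by rewrite mulr0; exact: Ideal0.
- by rewrite mulrDr; exact: IdealD.
Qed.

Lemma yh_idealMr a x : x \in yh_ideal -> x * a \in yh_ideal.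
Proof.
move=> /yh_idealP xI; apply/yh_idealP.
elim: xI => [b c y z r||y z _ IHy _ IHz].
- by rewrite -mulrA; exact: Ideal_rel.
- by rewrite mul0r; exact: Ideal0.
- by rewrite mulrDl; exact: IdealD.
Qed.

Lemma yh_ideal_zmod_closed : zmod_closed yh_ideal.
Proof.
split=> [|x y xI yI]; first by apply/yh_idealP; exact: Ideal0.
apply/yh_idealP/IdealD; first exact/yh_idealP.
by apply/yh_idealP; rewrite -mulN1r yh_idealMl.
Qed.

HB.instance Definition _ :=
  GRing.isZmodClosed.Build yh_free yh_ideal yh_ideal_zmod_closed.

(* The character t_j |-> 1, g_i |-> q (g_i |-> 1 in the degenerate cases where
   d or q is 0 in K) shows that the presented algebra is nonzero. *)
Definition yh_char_gen (x : yh_gen) : K :=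
  if x is inl _ then (if d%:R == 0 :> K then 1 else if q == 0 then 1 else q)
  else 1.

Definition yh_char_word (u : {fmonom yh_gen}) : K :=
  \prod_(x <- (u : seq yh_gen)) yh_char_gen x.

Fact yh_char_word_mmorphism : mmorphism yh_char_word.
Proof.
by split=> [u v|]; rewrite /yh_char_word ?fmM ?big_cat // fm1 big_nil.
Qed.

HB.instance Definition _ :=
  isMultiplicative.Build {fmonom yh_gen} K yh_char_word yh_char_word_mmorphism.

Definition yh_char (x : yh_free) : K := mmap idfun yh_char_word x.

Lemma yh_charD x y : yh_char (x + y) = yh_char x + yh_char y.
Proof. exact: mmapD. Qed.

Lemma yh_char0 : yh_char 0 = 0.
Proof. exact: mmap0. Qed.

Lemma yh_charB x y : yh_char (x - y) = yh_char x - yh_char y.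
Proof. exact: mmapB. Qed.

Lemma yh_charZ c x : yh_char (c *: x) = c * yh_char x.
Proof. exact: mmapZ. Qed.

Lemma yh_char1 : yh_char 1 = 1.
Proof. exact: mmap1. Qed.

Lemma yh_charM x y : yh_char (x * y) = yh_char x * yh_char y.
Proof. by case: (@mmap_is_multiplicative _ _ _ idfun yh_char_word) => fM _; exact: fM. Qed.

Lemma yh_charX x m : yh_char (x ^+ m) = yh_char x ^+ m.
Proof.
by elim: m => [|m IH]; rewrite ?expr0 ?yh_char1 // !exprS yh_charM IH.
Qed.

Lemma yh_char_g i : yh_char (free_g i) = yh_char_gen (inl i).
Proof. by rewrite /free_g /free_t -lock /yh_char mmapU mul1r /= /yh_char_word fmU big_seq1. Qed.

Lemma yh_char_t j : yh_char (free_t j) = 1.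
Proof. by rewrite /free_g /free_t -lock /yh_char mmapU mul1r /= /yh_char_word fmU big_seq1. Qed.

Lemma yh_char_e i : yh_char (free_e i) = d%:R^-1 * d%:R.
Proof.
rewrite yh_charZ (big_morph _ yh_charD yh_char0); congr (_ * _).
rewrite (eq_bigr (fun=> 1)) ?sumr_const ?card_ord // => s _.
by rewrite yh_charM 2!yh_charX !yh_char_t !expr1n mulr1.
Qed.

Lemma yh_charC x y : yh_char (x * y) = yh_char (y * x).
Proof.
exact: etrans (yh_charM _ _) (etrans (mulrC _ _) (esym (yh_charM _ _))).
Qed.

Lemma yh_charM3 x y z :
  yh_char (x * y * z) = yh_char x * yh_char y * yh_char z.
Proof. exact: etrans (yh_charM _ _) (congr1 ( *%R^~ _) (yh_charM _ _)). Qed.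

Lemma yh_char_relation x y : yh_relation x y -> yh_char x = yh_char y.
Proof.
case=> [i j _|i j _|i j|i j|j|i].
- exact: yh_charC.
- by apply: etrans (yh_charM3 _ _ _) (etrans _ (esym (yh_charM3 _ _ _)));
    rewrite !yh_char_g.
- exact: yh_charC.
- apply: etrans (yh_charM _ _) (etrans _ (esym (yh_charM _ _))).
  by rewrite !yh_char_t [LHS]mulrC.
- by rewrite yh_charX yh_char_t expr1n yh_char1.
- rewrite yh_charX yh_charD yh_char1 yh_charZ yh_charM yh_char_e.
  rewrite yh_char_g /=.
  case: eqP => [->|/eqP d0]; first by rewrite mulr0 mul0r mulr0 addr0 expr1n.
  rewrite mulVf // mul1r; case: eqP => [->|/eqP q0].
    by rewrite invr0 subr0 mul0r addr0 expr1n.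
  by rewrite mulrBl mulVf // addrC -expr2 subrK.
Qed.

Lemma yh_char_ideal x : x \in yh_ideal -> yh_char x = 0.
Proof.
move=> /yh_idealP; elim=> [a b y z /yh_char_relation yz||y z _ y0 _ z0].
- by rewrite !yh_charM yh_charB yz subrr mulr0 mul0r.
- exact: yh_char0.
- by rewrite yh_charD y0 z0 addr0.
Qed.

Definition YH : Type := Quotient.quot yh_ideal.

HB.instance Definition _ := GRing.Zmodule.on YH.
HB.instance Definition _ := EqQuotient.on YH.

Definition yh_pi (x : yh_free) : YH := \pi_YH x.

Lemma yh_piP x y : yh_pi x = yh_pi y <-> x - y \in yh_ideal.
Proof.
split=> [/eqP|xy]; first by rewrite -Quotient.idealrBE.
by apply/eqP; rewrite -Quotient.idealrBE.
Qed.

Lemma yh_piD x y : yh_pi (x + y) = yh_pi x + yh_pi y.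
Proof. exact: Quotient.pi_add. Qed.

Lemma yh_pi0 : yh_pi 0 = 0.
Proof. by apply: (addIr (yh_pi 0)); rewrite -yh_piD addr0 add0r. Qed.

Lemma yh_pi_repr (a : YH) : yh_pi (repr a) = a.
Proof. exact: reprK. Qed.

Definition yh_one : YH := lift_cst YH 1.
Definition yh_mul : YH -> YH -> YH := lift_op2 YH *%R.
Definition yh_scale (c : K) : YH -> YH := lift_op1 YH ( *:%R c).

Lemma yh_repr_pi x : repr (yh_pi x) - x \in yh_ideal.
Proof. by apply/yh_piP; rewrite yh_pi_repr. Qed.

Lemma yh_pi1 : yh_pi 1 = yh_one.
Proof. by rewrite /yh_one -lock. Qed.

Lemma yh_piM x y : yh_pi (x * y) = yh_mul (yh_pi x) (yh_pi y).
Proof.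
rewrite /yh_mul -lock; apply/esym/yh_piP.
have -> : repr (yh_pi x) * repr (yh_pi y) - x * y =
  (repr (yh_pi x) - x) * repr (yh_pi y) + x * (repr (yh_pi y) - y).
  by rewrite mulrBl mulrBr addrA subrK.
by apply: rpredD; [apply: yh_idealMr | apply: yh_idealMl]; exact: yh_repr_pi.
Qed.

Lemma yh_piZ c x : yh_pi (c *: x) = yh_scale c (yh_pi x).
Proof.
rewrite /yh_scale -lock; apply/esym/yh_piP; rewrite -scalerBr -mul_malgC.
by rewrite yh_idealMl ?yh_repr_pi.
Qed.

Fact yh_mulA : associative yh_mul.
Proof.
by move=> a b c; rewrite -[a]yh_pi_repr -[b]yh_pi_repr -[c]yh_pi_repr
  -!yh_piM mulrA.
Qed.

Fact yh_mul1 : left_id yh_one yh_mul.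
Proof. by move=> a; rewrite -[a]yh_pi_repr -yh_pi1 -yh_piM mul1r. Qed.

Fact yh_mulr1 : right_id yh_one yh_mul.
Proof. by move=> a; rewrite -[a]yh_pi_repr -yh_pi1 -yh_piM mulr1. Qed.

Fact yh_mulDl : left_distributive yh_mul +%R.
Proof.
by move=> a b c; rewrite -[a]yh_pi_repr -[b]yh_pi_repr -[c]yh_pi_repr
  -yh_piD -!yh_piM -yh_piD mulrDl.
Qed.

Fact yh_mulDr : right_distributive yh_mul +%R.
Proof.
by move=> a b c; rewrite -[a]yh_pi_repr -[b]yh_pi_repr -[c]yh_pi_repr
  -yh_piD -!yh_piM -yh_piD mulrDr.
Qed.

Fact yh_one_neq0 : yh_one != 0.
Proof.
apply/eqP; rewrite -yh_pi1 -yh_pi0 => /yh_piP.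
by rewrite subr0 => /yh_char_ideal; rewrite yh_char1 => /eqP; rewrite oner_eq0.
Qed.

HB.instance Definition _ := GRing.Zmodule_isNzRing.Build YH
  yh_mulA yh_mul1 yh_mulr1 yh_mulDl yh_mulDr yh_one_neq0.

Fact yh_scaleA b c a : yh_scale b (yh_scale c a) = yh_scale (b * c) a.
Proof. by rewrite -[a]yh_pi_repr -!yh_piZ scalerA. Qed.

Fact yh_scale1 : left_id 1 yh_scale.
Proof. by move=> a; rewrite -[a]yh_pi_repr -yh_piZ scale1r. Qed.

Fact yh_scaleDr : right_distributive yh_scale +%R.
Proof.
by move=> c a b; rewrite -[a]yh_pi_repr -[b]yh_pi_repr
  -yh_piD -!yh_piZ -yh_piD scalerDr.
Qed.

Fact yh_scaleDl a : {morph yh_scale^~ a : b c / b + c}.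
Proof.
by move=> b c; rewrite -[a]yh_pi_repr -!yh_piZ -yh_piD scalerDl.
Qed.

HB.instance Definition _ := GRing.Zmodule_isLmodule.Build K YH
  yh_scaleA yh_scale1 yh_scaleDr yh_scaleDl.

Fact yh_scaleAl c a b : yh_scale c (yh_mul a b) = yh_mul (yh_scale c a) b.
Proof.
by rewrite -[a]yh_pi_repr -[b]yh_pi_repr -yh_piM -!yh_piZ -yh_piM scalerAl.
Qed.

HB.instance Definition _ := GRing.Lmodule_isLalgebra.Build K YH yh_scaleAl.

Lemma free_malgCC c (x : yh_free) : c%:MP * x = x * c%:MP.
Proof.
apply: etrans (fgmulUg _ _ _) (etrans _ (esym (fgmulgU _ _ _))).
by apply: eq_bigr => u _; rewrite [c * _]mulrC mul1m mulm1.
Qed.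

Lemma free_scaleAr c (x y : yh_free) : c *: (x * y) = x * (c *: y).
Proof.
apply: etrans (esym (mul_malgC c (x * y))) (etrans (mulrA _ _ _) _).
apply: etrans (congr1 ( *%R^~ y) (free_malgCC c x)) _.
apply: etrans (esym (mulrA _ _ _)) _.
exact: congr1 (mul_malgC c y).
Qed.

Fact yh_scaleAr c a b : yh_scale c (yh_mul a b) = yh_mul a (yh_scale c b).
Proof.
rewrite -[a]yh_pi_repr -[b]yh_pi_repr -yh_piM -!yh_piZ -yh_piM.
by rewrite free_scaleAr.
Qed.

HB.instance Definition _ := GRing.Lalgebra_isAlgebra.Build K YH yh_scaleAr.

Lemma yh_pi_relation x y : yh_relation x y -> yh_pi x = yh_pi y.
Proof.
move=> xy; apply/yh_piP/yh_idealP.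
by rewrite -[x - y]mul1r -[1 * _]mulr1; exact: Ideal_rel.
Qed.

Definition yh_g (i : 'I_n.-1) : YH := yh_pi (free_g i).
Definition yh_t (j : 'I_n) : YH := yh_pi (free_t j).

Definition yh_e (i : 'I_n.-1) : YH :=
  (d%:R^-1 : K) *: \sum_(s < d) yh_t (slo i) ^+ s * yh_t (shi i) ^+ (d - s).

Lemma yh_pi_mul x y : yh_pi (x * y) = yh_pi x * yh_pi y.
Proof. exact: yh_piM. Qed.

Lemma yh_pi_scale c x : yh_pi (c *: x) = c *: yh_pi x.
Proof. exact: yh_piZ. Qed.

Lemma yh_pi_one : yh_pi 1 = 1.
Proof. exact: yh_pi1. Qed.

Lemma yh_pi_exp x m : yh_pi (x ^+ m) = yh_pi x ^+ m.
Proof.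
elim: m => [|m IH]; first by rewrite !expr0 yh_pi_one.
by rewrite exprS [RHS]exprS yh_pi_mul IH.
Qed.

Lemma yh_pi_e i : yh_pi (free_e i) = yh_e i.
Proof.
rewrite yh_pi_scale (big_morph _ yh_piD yh_pi0); congr (_ *: _).
by apply: eq_bigr => s _; rewrite yh_pi_mul 2!yh_pi_exp.
Qed.

Lemma yh_pi_mul3 x y z : yh_pi (x * y * z) = yh_pi x * yh_pi y * yh_pi z.
Proof. exact: etrans (yh_pi_mul _ _) (congr1 ( *%R^~ _) (yh_pi_mul _ _)). Qed.

Lemma yh_gg (i j : 'I_n.-1) : (i.+1 < j)%N || (j.+1 < i)%N ->
  yh_g i * yh_g j = yh_g j * yh_g i.
Proof.
move=> ij; apply: etrans (esym (yh_pi_mul _ _)) (etrans _ (yh_pi_mul _ _)).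
exact: yh_pi_relation (Rel_gg ij).
Qed.

Lemma yh_braid (i j : 'I_n.-1) : j = i.+1 :> nat ->
  yh_g i * yh_g j * yh_g i = yh_g j * yh_g i * yh_g j.
Proof.
move=> ij; apply: etrans (esym (yh_pi_mul3 _ _ _)) (etrans _ (yh_pi_mul3 _ _ _)).
exact: yh_pi_relation (Rel_braid ij).
Qed.

Lemma yh_tt (i j : 'I_n) : yh_t i * yh_t j = yh_t j * yh_t i.
Proof.
apply: etrans (esym (yh_pi_mul _ _)) (etrans _ (yh_pi_mul _ _)).
exact: yh_pi_relation (Rel_tt i j).
Qed.

Lemma yh_tg (i : 'I_n.-1) (j : 'I_n) :
  yh_t j * yh_g i = yh_g i * yh_t (simple_transp i j).
Proof.
apply: etrans (esym (yh_pi_mul _ _)) (etrans _ (yh_pi_mul _ _)).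
exact: yh_pi_relation (Rel_tg i j).
Qed.

Lemma yh_td (j : 'I_n) : yh_t j ^+ d = 1.
Proof.
apply: etrans (esym (yh_pi_exp _ _)) (etrans _ yh_pi_one).
exact: yh_pi_relation (Rel_td j).
Qed.

Lemma yh_gquad (i : 'I_n.-1) :
  yh_g i ^+ 2 = 1 + (q - q^-1) *: (yh_e i * yh_g i).
Proof.
rewrite -yh_pi_e; apply: etrans (esym (yh_pi_exp _ _)) _.
apply: etrans (yh_pi_relation (Rel_gquad i)) _.
apply: etrans (yh_piD _ _) (congr2 _ yh_pi_one _).
exact: etrans (yh_pi_scale _ _) (congr1 _ (yh_pi_mul _ _)).
Qed.

(* The element t_1^(k_1) ... t_n^(k_n) g_w, where u is a reduced expression
   of w. *)
Definition yh_monomial (k : 'I_n -> 'I_d) (u : seq 'I_n.-1) : YH :=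
  (\prod_(j < n) yh_t j ^+ k j) * \prod_(i <- u) yh_g i.

Definition canonical_trace_form (tau : {scalar YH}) : Prop :=
  forall (k : 'I_n -> 'I_d) (w : 'S_n) (u : seq 'I_n.-1),
    reduced_expression w u ->
    tau (yh_monomial k u) = ([forall j, k j == 0 :> nat] && (w == 1%g))%:R.

End YokonumaHecke.

(* Partitions are sequences of naturals, possibly padded with zeros; rows and
   columns are numbered from 0. *)
Definition conj_part (l : seq nat) (y : nat) : nat := count (ltn y) l.

Definition eta_part (l : seq nat) : nat :=
  (\sum_(i < size l) i * nth 0 l i)%N.

Section DPartitions.

Variables d n : nat.

(* A partition of size at most n has at most n parts, each at most n, so it is
   a weakly decreasing n-tuple of elements of {0, ..., n}, padded with zeros. *)
Definition is_dpart (l : {ffun 'I_d -> n.-tuple 'I_n.+1}) : bool :=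
  [forall k, sorted geq (map val (l k))]
  && (\sum_(k < d) sumn (map val (l k)) == n)%N.

Record dpart := DPart {
  dpart_val : {ffun 'I_d -> n.-tuple 'I_n.+1};
  _ : is_dpart dpart_val }.

HB.instance Definition _ := [isSub for dpart_val].
HB.instance Definition _ := [Finite of dpart by <:].

Definition part (lam : dpart) (k : 'I_d) : seq nat :=
  map val (dpart_val lam k).

Definition eta (lam : dpart) : nat := (\sum_(k < d) eta_part (part lam k))%N.

(* The triple (x, y, k): row x, column y, position k. *)
Definition dnode : Type := ('I_n * 'I_n * 'I_d)%type.

HB.instance Definition _ := Finite.on dnode.

Definition node_row (th : dnode) : 'I_n := th.1.1.
Definition node_col (th : dnode) : 'I_n := th.1.2.
Definition node_pos (th : dnode) : 'I_d := th.2.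

Definition nodes (lam : dpart) : {set dnode} :=
  [set th | node_col th < nth 0 (part lam (node_pos th)) (node_row th)]%N.

(* With x = node_row th + 1 and y = node_col th + 1, this is
   (lam^(k)_x - y) + (lam^(k)'_y - x) + 1; on nodes of lam neither
   subtraction is truncated. *)
Definition hook_length (lam : dpart) (th : dnode) : nat :=
  let l := part lam (node_pos th) in
  (nth 0 l (node_row th) - (node_col th).+1
   + (conj_part l (node_col th) - (node_row th).+1) + 1)%N.

Definition is_tableau (lam : dpart) (T : {ffun 'I_n -> dnode}) : bool :=
  injectiveb T && (T @: [set: 'I_n] == nodes lam).

Definition is_standard (T : {ffun 'I_n -> dnode}) : bool :=
  [forall i, forall j,
    (node_pos (T i) == node_pos (T j)) ==>
      ((node_row (T i) == node_row (T j)) && (node_col (T i) < node_col (T j))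
       || (node_col (T i) == node_col (T j))
          && (node_row (T i) < node_row (T j)))%N ==>
    (i < j)%N].

Record stdtab (lam : dpart) := StdTab {
  stdtab_val :> {ffun 'I_n -> dnode};
  _ : is_tableau lam stdtab_val && is_standard stdtab_val }.

HB.instance Definition _ lam := [isSub for @stdtab_val lam].
HB.instance Definition _ lam := [Finite of stdtab lam by <:].

(* T^s has s i in the node where T has i. *)
Definition tab_act (T : {ffun 'I_n -> dnode}) (s : 'S_n) :
    {ffun 'I_n -> dnode} :=
  [ffun i => T ((s^-1)%g i)].

End DPartitions.

Section SeminormalForm.

Variables (K : fieldType) (q : K) (d n : nat).

Definition quantum_content (th : dnode d n) : K :=
  q ^ (((node_col th)%:Z - (node_row th)%:Z) * 2).

Definition tab_vec (lam : dpart d n) (T : {ffun 'I_n -> dnode d n}) :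
    'cV[K]_#|{: stdtab lam}| :=
  if insub T is Some U then delta_mx (enum_rank (U : stdtab lam)) 0 else 0.

(* rho is the action on V_lam, with v_T identified with tab_vec lam T. *)
Definition seminormal_rep (xi : 'I_d -> K) (lam : dpart d n)
    (rho : YH q d n -> 'M[K]_#|{: stdtab lam}|) : Prop :=
  [/\ linear rho,
      monoid_morphism rho,
      forall (j : 'I_n) (T : stdtab lam),
        rho (yh_t q d j) *m tab_vec lam T
        = xi (node_pos (T j)) *: tab_vec lam T
    & forall (i : 'I_n.-1) (T : stdtab lam),
        let c := quantum_content (T (slo i)) in
        let c' := quantum_content (T (shi i)) in
        let Ts := tab_act T (simple_transp i) in
        rho (yh_g q d i) *m tab_vec lam T =
        if node_pos (T (slo i)) == node_pos (T (shi i)) then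
          (c' * (q - q^-1) / (c' - c)) *: tab_vec lam T
          + ((q * c' - q^-1 * c) / (c' - c)) *: tab_vec lam Ts
        else tab_vec lam Ts].

Definition qint (h : nat) : K := (q ^+ (2 * h) - 1) / (q ^+ 2 - 1).

Lemma qintE h : q ^+ 2 != 1 -> qint h = \sum_(i < h) q ^+ (2 * i).
Proof.
move=> q21; rewrite /qint exprM subrX1 mulrAC divff ?subr_eq0 // mul1r.
by apply: eq_bigr => i _; rewrite exprM.
Qed.

End SeminormalForm.

Section ComplexRationalFunctions.

Variable R : realType.

Definition Cq : fieldType := {fraction {poly R[i]}}.

Definition qvar : Cq := tofrac ('X : {poly R[i]}).

Definition Cq_const (a : R[i]) : Cq := tofrac (a%:P).

Definition is_laurent (x : Cq) : Prop :=
  exists (p : {poly R[i]}) (m : nat), x = tofrac p * qvar ^- m.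

Variables d n : nat.

Definition CqYH : algType Cq := YH qvar d n.

(* s is the family of Schur elements for the form tau, where the character of
   V_mu is the trace of rho mu. *)
Definition schur_elements (tau : CqYH -> Cq)
    (rho : forall mu : dpart d n, CqYH -> 'M[Cq]_#|{: stdtab mu}|)
    (s : dpart d n -> Cq) : Prop :=
  [/\ forall mu, is_laurent (s mu),
      forall mu, s mu != 0
    & forall a, tau a = \sum_(mu : dpart d n) (s mu)^-1 * \tr (rho mu a)].

End ComplexRationalFunctions.

(* Main.v *)
Require Import Defs.
From mathcomp Require Import all_boot all_order all_algebra all_fingroup.
From mathcomp Require Import reals complex fraction monalg.
From mathcomp Require Import zify ring.

(** Let w_lam be the inverse of the right-hand side. The form with values
    sum_mu w_mu chi_mu turns out to take the value 1 on the basis element 1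
    and 0 on the other elements t_1^k_1 ... t_n^k_n g_w, so it is tau. The
    characters chi_mu are linearly independent, hence 1 / s_mu = w_mu for all
    mu.

    The values on the basis come from a growth process for d-partitions, whose
    transition weights are rational functions of q. A standard d-tableau with
    n entries is a path in the branching graph; it is encoded as a word whose
    i-th letter is the (position, row) of entry i. The weight w_lam is the
    product of the transition weights along any path to lam
    (path_weight_lattice): the ratio of two consecutive weights is computed
    from the expression of the hook lengths of a row by beta numbers
    (perm_hook_row). In terms of the contents, the transition weights are the
    quantities of a Lagrange interpolation, which gives two identities: in
    each position they sum to 1 / d (sum_step_weight), and the diagonal
    seminormal coefficient of g_i has average 0 over the places of the larger
    entry (sum_step_weight_content).

    Each permutation has a reduced word made of one descending run m, m - 1,
    ... for each m (normal_word); some of the runs may be empty. In the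
    weighted trace of such a product, the largest generator occurs only once;
    it exchanges the last entry with another one, so only its diagonal
    coefficient counts and the sum over the places of the last entry is 0
    (word_trace_crossing). If there is no such generator, the last entry can
    be summed out (word_trace_restrict), and the power sums of the d-th roots
    of unity leave only the trivial exponent. By induction the weighted trace
    is the canonical form on the monomials of normal words
    (word_trace_normal).

    Two facts about the algebra complete the argument: these monomials span it
    (monomial_span_all) and their words are reduced (normal_word_reduced), so
    that tau is known on them; and the Jucys--Murphy elements together with
    the t_j act on the tableau bases diagonally with simple joint spectrum,
    which yields elements that separate the characters
    (trace_combination_eq0). *)

Set Implicit Arguments.
Unset Strict Implicit.
Unset Printing Implicit Defensive.

Import GRing.Theory.
Local Open Scope ring_scope.

(** * Lagrange interpolation and transition weights *)

Lemma big_option_Some (S : Type) (idx : S) (op : Monoid.com_law idx)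
    (I : finType) (P : pred (option I)) (F : option I -> S) :
  \big[op/idx]_(o | P o && (o != None)) F o
  = \big[op/idx]_(i | P (Some i)) F (Some i).
Proof.
rewrite (reindex_omap Some id) => [|[i|] /andP[]//].
by apply: eq_bigl => i; rewrite !andbT eqxx andbT.
Qed.

Section Interpolation.

Variable K : fieldType.

(** The Lagrange interpolant of P at the points x i is P, and the sum is its
    coefficient of degree #|I| - 1. *)
Lemma lagrange_sum0 (I : finType) (x : I -> K) (P : {poly K}) :
  injective x -> (size P < #|I|)%N ->
  \sum_i P.[x i] / \prod_(j | j != i) (x i - x j) = 0.
Proof.
move=> xinj sP.
pose B i : {poly K} := \prod_(j | j != i) ('X - (x j)%:P).
have sB i : size (B i) = #|I|.
  rewrite /B -big_filter size_prod_XsubC.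
  have [e _ _ [_ ->]] := big_enumP; rewrite cardC1 prednK //.
  by apply/card_gt0P; exists i.
have lB i : (B i)`_(#|I|.-1) = 1.
  have : B i \is monic by apply: monic_prod => j _; exact: monicXsubC.
  by rewrite monicE lead_coefE sB => /eqP.
have Bx i : (B i).[x i] = \prod_(j | j != i) (x i - x j).
  by rewrite horner_prod; apply: eq_bigr => j _; rewrite hornerXsubC.
have Bx0 i j : j != i -> (B i).[x j] = 0.
  move=> ji; rewrite horner_prod (bigD1 j) //= hornerXsubC subrr mul0r //.
have den i : \prod_(j | j != i) (x i - x j) != 0.
  by apply/prodf_neq0 => j ji; rewrite subr_eq0 (inj_eq xinj) eq_sym.
pose R := \sum_i (P.[x i] / \prod_(j | j != i) (x i - x j)) *: B i.
have PR : R - P = 0.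
  apply: (@roots_geq_poly_eq0 _ _ [seq x i | i <- enum I]).
  - apply/allP => _ /mapP[i _ ->]; rewrite /root hornerD hornerN horner_sum.
    rewrite (bigD1 i) //= [X in _ + X - _]big1 ?addr0 => [|j ji].
      by rewrite hornerZ Bx divfK ?subrr.
    by rewrite hornerZ Bx0 ?mulr0 // eq_sym.
  - by rewrite map_inj_uniq ?enum_uniq.
  - rewrite size_map -cardE; apply: (leq_trans (size_polyD _ _)).
    rewrite geq_max size_polyN (ltnW sP) andbT.
    apply: (leq_trans (size_sum _ _ _)); apply/bigmax_leqP => i _.
    by apply: (leq_trans (size_scale_leq _ _)); rewrite sB.
have /(congr1 (fun p : {poly K} => p`_(#|I|.-1))) := PR.
rewrite coef0 coefB [X in _ - X]nth_default ?subr0; last first.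
  by rewrite -ltnS prednK // (leq_ltn_trans _ sP).
rewrite coef_sum => {2}<-; apply: eq_bigr => i _.
by rewrite coefZ lB mulr1.
Qed.

Variables (Q : K).

(** Let Q = q^2 and x i = q^(2 l_i), where the l_i are the beta numbers of a
    partition. This is the factor by which q^(2 eta) divided by the product
    of the quantum hook lengths changes when a box is added to row i. It is
    0 when row i is as long as the row above, for then Q * x i is the x of
    that row. *)
Definition hook_ratio (I : finType) (x : I -> K) (i : I) : K :=
  (Q - 1) / (Q * x i - 1) * \prod_(j | j != i) ((Q * x i - x j) / (x i - x j)).

(** A row z with x z = 1 is the last row and is empty. Its factor cancels Q
    * x i - 1, and what remains is, up to 1 / x i, the value at x i of a
    polynomial over a Lagrange denominator. *)
Lemma hook_ratio_prod (I : finType) (x : I -> K) (z i : I) :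
  injective x -> x i != 0 -> Q * x i != 1 -> x z = 1 ->
  hook_ratio x i = (\prod_(j | j != z) (Q * x i - x j)) / x i
                   / \prod_(j | j != i) (x i - x j).
Proof.
move=> xinj xi0 Qxi xz; rewrite /hook_ratio big_split /= prodfV mulrA.
congr (_ / _); have d1 : Q * x i - 1 != 0 by rewrite subr_eq0.
transitivity ((\prod_j (Q * x i - x j)) / (x i * (Q * x i - 1))).
  rewrite [in RHS](bigD1 i) //=; set p := \prod_(_ | _) _; field; exact/andP.
rewrite (bigD1 z) //= xz; set p := \prod_(_ | _) _; field; exact/andP.
Qed.

Variables (I : finType) (x : I -> K) (z : I).
Hypotheses (xinj : injective x) (x_neq0 : forall i, x i != 0)
  (Qx1 : forall i, Q * x i != 1) (xz : x z = 1).

Lemma size_prod_linear (A : pred I) :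
  (size (\prod_(j | A j) (Q *: 'X - (x j)%:P))%R <= #|A|.+1)%N.
Proof.
rewrite -sum1_card; elim/big_rec2: _ => [|j m p _ sp];
  first by rewrite size_poly1.
apply: (leq_trans (size_polyMleq _ _)).
have : (size (Q *: 'X - (x j)%:P)%R <= 2)%N.
  apply: (leq_trans (size_polyD _ _)); rewrite geq_max size_polyN.
  rewrite (leq_trans (size_scale_leq _ _)) ?size_polyX //=.
  by rewrite (leq_trans (size_polyC_leq1 _)).
by move: sp => /=; lia.
Qed.

(** Lagrange interpolation at the points x i and 0: the additional point
    produces the denominator x i of hook_ratio_prod, and its own term is -1. *)
Lemma sum_hook_ratio : \sum_i hook_ratio x i = 1.
Proof.
pose P : {poly K} := \prod_(j | j != z) (Q *: 'X - (x j)%:P).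
have PE y : P.[y] = \prod_(j | j != z) (Q * y - x j).
  by rewrite horner_prod; apply: eq_bigr => j _; rewrite !hornerE.
(* None stands for the additional interpolation point 0. *)
pose y (o : option I) := if o is Some i then x i else 0.
have yinj : injective y.
  case=> [i|] [j|] //= => [/xinj ->//|/eqP|/esym/eqP];
    by rewrite (negPf (x_neq0 _)).
have sP : (size P < #|{: option I}|)%N.
  rewrite card_option ltnS (leq_trans (size_prod_linear _)) // cardC1 prednK //.
  by apply/card_gt0P; exists z.
have := lagrange_sum0 yinj sP.
rewrite (bigD1 None) //= !(big_option_Some _ predT) /= => /eqP.
have -> : P.[0] / \prod_i (0 - x i) = -1.
  rewrite PE [X in X / _](eq_bigr (fun j => - x j)) => [|j _];
    last by rewrite mulr0 sub0r.
  rewrite [X in _ / X](eq_bigr (fun j => - x j)) => [|j _];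
    last by rewrite sub0r.
  rewrite [X in _ / X](bigD1 z) //= xz mulN1r invrN mulrN divff //.
  by apply/prodf_neq0 => j _; rewrite oppr_eq0.
rewrite addrC subr_eq0 => /eqP <-; apply: eq_bigr => i _.
rewrite (hook_ratio_prod xinj _ _ xz) // PE -mulrA -invfM; congr (_ / _).
by rewrite (bigD1 None) //= subr0 big_option_Some.
Qed.

(** Up to a common factor, x i is the content of the box that can be added
    to row i, and x r / Q that of the last box of row r. The factor Q * x i
    - x r of the numerator cancels the new denominator, which leaves a
    polynomial of degree #|I| - 2. The last hypothesis says that the last
    box of row r is removable. *)
Lemma sum_hook_ratio_content (r : I) : r != z -> Q != 0 ->
  (forall i, Q * x i != x r) ->
  \sum_i hook_ratio x i * (x i / (x i - x r / Q)) = 0.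
Proof.
move=> rz Q0 Qxr.
pose P : {poly K} := Q *: \prod_(j | (j != z) && (j != r)) (Q *: 'X - (x j)%:P).
have PE y : P.[y] = Q * \prod_(j | (j != z) && (j != r)) (Q * y - x j).
  rewrite hornerZ; congr (_ * _).
  by rewrite horner_prod; apply: eq_bigr => j _; rewrite !hornerE.
have sP : (size P < #|I|)%N.
  rewrite (leq_ltn_trans (size_scale_leq _ _)) //.
  rewrite (leq_ltn_trans (size_prod_linear _)) //.
  have := cardC [pred i in [:: z; r]]; rewrite (card_uniqP _) /=; last first.
    by rewrite inE eq_sym rz.
  have -> : #|[predC [pred i in [:: z;
    r]]]| = #|[pred j | (j != z) && (j != r)]|.
    by apply: eq_card => i; rewrite !inE negb_or.
  by move=> <-.
rewrite -[RHS](lagrange_sum0 xinj sP); apply: eq_bigr => i _.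
rewrite (hook_ratio_prod xinj _ _ xz) // PE (bigD1 r) //=.
have := Qxr i; rewrite -subr_eq0 => Hr.
have d2 : x i - x r / Q != 0.
  apply: contraNneq Hr => Z.
  by rewrite -(mulr0 Q) -Z mulrBr [Q * (_ / _)]mulrC divfK.
set p := \prod_(_ | _) _; set p' := \prod_(_ | _) (x i - _).
transitivity (Q * p / p'); last by [].
field; apply/and4P; split=> //; last by rewrite [x i * Q]mulrC.
by apply/prodf_neq0 => j ji; rewrite subr_eq0 (inj_eq xinj) eq_sym.
Qed.

End Interpolation.

(** * Hook lengths and beta numbers *)

Section HookLengths.

Implicit Types (l : seq nat) (r c : nat).

Lemma ltn_conj_part l r c : sorted geq l ->
  (r < conj_part l c)%N = (c < nth 0%N l r)%N.
Proof.
elim: l r => [|a l IH] r /=; first by rewrite nth_nil.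
move=> pl; have sl := path_sorted pl.
have [ca|ac] := ltnP c a.
  by case: r => [|r] /=; rewrite ?add1n // ltnS; exact: IH.
have /allP la : all (geq a) l.
  by apply: order_path_min pl => x y z /=; lia.
have -> : (0 + conj_part l c = 0)%N.
  apply/eqP; rewrite add0n -leqn0 leqNgt -has_count -all_predC.
  by apply/allP => b /la /=; lia.
case: r => [|r] /=; first by lia.
have [sr|sr] := ltnP r (size l); last by rewrite nth_default.
by have := la _ (mem_nth 0%N sr); rewrite /=; lia.
Qed.

Definition hook l r c : nat :=
  (nth 0%N l r - c.+1 + (conj_part l c - r.+1) + 1)%N.

Definition beta_number l r : nat := (nth 0%N l r + ((size l).-1 - r))%N.

Lemma nth_sorted_geq l i j : sorted geq l -> (i <= j)%N ->
  (nth 0%N l j <= nth 0%N l i)%N.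
Proof.
move=> sl ij; have [sj|sj] := ltnP j (size l); last by rewrite nth_default.
apply: (sorted_leq_nth (leT := geq)) => //.
- by move=> x y z /=; lia.
- exact: leqnn.
- by rewrite inE (leq_ltn_trans ij).
Qed.

(** Along a row the hook lengths decrease strictly, and the differences of
    beta numbers increase strictly with j. A hook length of column c can
    only equal the difference for row j if the box (j, c) is neither in the
    diagram nor outside. All these numbers lie between 1 and the beta
    number, and there are as many of them, so each occurs once. *)
Lemma perm_hook_row l r : sorted geq l -> (r < size l)%N ->
  perm_eq ([seq hook l r c | c <- iota 0 (nth 0%N l r)]
           ++ [seq beta_number l r - beta_number l j
                 | j <- iota r.+1 (size l - r.+1)])%N
          (iota 1 (beta_number l r)).
Proof.
move=> sl rl; set s := _ ++ _.
have cP i c := @ltn_conj_part l i c sl.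
have dec i j := @nth_sorted_geq l i j sl.
have us : uniq s.
  rewrite cat_uniq; apply/and3P; split.
  - rewrite map_inj_in_uniq ?iota_uniq // => c c';
    rewrite !mem_iota /= => cr c'r.
    wlog cc' : c c' cr c'r / (c <= c')%N.
      by move=> W; case: (leqP c c') => [|/ltnW] h E; [|symmetry]; apply: W.
    have : (conj_part l c' <= conj_part l c)%N.
      by apply: sub_count => x /=; lia.
    have := cP r c; have := cP r c'; rewrite /hook; lia.
  - apply/hasPn => x /mapP[j]; rewrite mem_iota => jl {x}->.
    apply/negP => /mapP[c]; rewrite mem_iota /= => cr.
    have := cP j c; have := cP r c; have := dec r j; rewrite /hook /beta_number.
    by lia.
  - rewrite map_inj_in_uniq ?iota_uniq // => i j; rewrite !mem_iota => il jl.
    have := dec r i; have := dec r j; have := dec i j; have := dec j i.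
    by rewrite /beta_number; lia.
have ss : {subset s <= iota 1 (beta_number l r)}.
  move=> x; rewrite mem_cat mem_iota => /orP[] /mapP[c];
    rewrite mem_iota => cl {x}->.
  - have : (conj_part l c <= size l)%N by exact: count_size.
    by have := cP r c; rewrite /hook /beta_number; lia.
  - by have := dec r c; rewrite /beta_number; lia.
have [|_ sE] := uniq_min_size us ss.
  by rewrite size_cat !size_map !size_iota /beta_number; lia.
by apply: uniq_perm; rewrite ?iota_uniq.
Qed.

Variables (K : fieldType) (q : K).

Lemma hook_row_prod l r : sorted geq l -> (r < size l)%N ->
  (\prod_(c < nth 0%N l r) qint q (hook l r c))
  * (\prod_(j < size l | (r < j)%N) qint q (beta_number l r - beta_number l j))
  = \prod_(h < beta_number l r) qint q h.+1.
Proof.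
move=> sl rl.
rewrite -(big_mkord predT (fun c => qint q (hook l r c))).
rewrite -(big_mkord (fun j => r < j)%N
  (fun j => qint q (beta_number l r - beta_number l j))).
rewrite -(big_mkord predT (fun h => qint q h.+1)).
transitivity (\prod_(i <- iota 1 (beta_number l r)) qint q i); last first.
  by rewrite -(big_add1 _ _ 0 (beta_number l r).+1 predT (qint q)) /index_iota
    subn1.
rewrite -(perm_big _ (perm_hook_row sl rl)) /= big_cat /= !big_map.
congr (_ * _); first by rewrite /index_iota subn0.
rewrite -/(index_iota r.+1 (size l)) (big_nat_widenl r.+1 0) //=.
Qed.

End HookLengths.

(** * Adding a box to a partition *)

Section AddBox.

Variables (K : fieldType) (q : K).
Hypotheses (q_neq0 : q != 0) (q_gen : forall m, (0 < m)%N -> q ^+ m != 1).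

Lemma q_exp_inj : injective (GRing.exp q).
Proof.
have W i j : (i < j)%N -> q ^+ i != q ^+ j.
  move=> ij; rewrite -(subnK (ltnW ij)) exprD -{1}[q ^+ i]mul1r eq_sym.
  by rewrite (inj_eq (mulIf _)) ?expf_neq0 // q_gen // subn_gt0.
move=> i j /eqP E; case: (ltngtP i j) => // /W; first by rewrite E.
by rewrite eq_sym E.
Qed.

Lemma qint_neq0 h : (0 < h)%N -> qint q h != 0.
Proof.
move=> h0; rewrite mulf_neq0 ?invr_neq0 // subr_eq0 q_gen //.
by rewrite muln_gt0.
Qed.

Lemma qintB a b : (b <= a)%N ->
  qint q (a - b) = (q ^+ (2 * a) / q ^+ (2 * b) - 1) / (q ^+ 2 - 1).
Proof.
by move=> ba; rewrite /qint mulnBr expfB_cond // (negPf q_neq0) leq_mul2l ba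
  orbT.
Qed.

Lemma prod_pairs (n : nat) (D : 'I_n -> 'I_n -> K) (r : 'I_n) :
  \prod_(i < n) \prod_(j < n | (i < j)%N) D i j
  = \prod_(j < n | (r < j)%N) D r j * \prod_(i < n | (i < r)%N) D i r
    * \prod_(i < n | i != r) \prod_(j < n | (i < j)%N && (j != r)) D i j.
Proof.
rewrite (bigD1 r) //= -mulrA; congr (_ * _).
rewrite [X in _ = X * _](eq_bigl (fun i => (i != r) && (i < r)%N)); last first.
  by move=> i; case: eqP => // ->; rewrite ltnn.
rewrite big_mkcondr /= -big_split; apply: eq_bigr => i ir /=.
by case: ifP => ilr; [rewrite (bigD1 r) | rewrite mul1r; apply: eq_bigl => j;
  rewrite andb_idr // => ij; apply: contraTneq ij => ->; rewrite ilr].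
Qed.

(** This is q^(2 l) for the beta number l of a row r with a boxes, in a
    partition with n rows. It is also q^(2 (n - 1)) times the quantum
    content of the box that can be added at the end of this row. *)
Definition box_param (n a r : nat) : K := q ^+ (2 * (a + (n.-1 - r))).

(** The contribution of one component of a d-partition to the inverse of the
    Schur element, powers of d apart. *)
Definition part_weight (l : seq nat) : K :=
  q ^+ (2 * eta_part l)
  / \prod_(r < size l) \prod_(c < nth 0%N l r) qint q (hook l r c).

Lemma box_param_inj n l : size l = n -> sorted geq l ->
  injective (fun i : 'I_n => box_param n (nth 0%N l i) i).
Proof.
move=> sz sl i j /q_exp_inj E; apply/val_inj/eqP => /=; move: E.
have := ltn_ord i; have := ltn_ord j.
have := @nth_sorted_geq l i j sl; have := @nth_sorted_geq l j i sl; lia.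
Qed.

Lemma part_weight_beta n l : size l = n -> sorted geq l ->
  part_weight l = q ^+ (2 * eta_part l)
    * \prod_(i < n) \prod_(j < n | (i < j)%N)
        qint q (beta_number l i - beta_number l j)
    / \prod_(i < n) \prod_(h < beta_number l i) qint q h.+1.
Proof.
move=> <- sl; rewrite /part_weight -[LHS]mulr1 -mulrA -[RHS]mulrA.
congr (_ * _); set V := \prod_(i < size l) \prod_(j < size l | _) _.
have V0 : V != 0.
  apply/prodf_neq0 => i _; apply/prodf_neq0 => j ij; rewrite qint_neq0 //.
  have := ltn_ord j; have := @nth_sorted_geq l i j sl.
  by rewrite subn_gt0 /beta_number; lia.
have <- : (\prod_(r < size l) \prod_(c < nth 0%N l r) qint q (hook l r c)) * V
    = \prod_(i < size l) \prod_(h < beta_number l i) qint q h.+1.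
  by rewrite -big_split; apply: eq_bigr => i _; rewrite /= hook_row_prod.
by rewrite invfM mulrCA divff // mulr1.
Qed.

(** In the expression by beta numbers only the factors that involve row r
    change. Compared with the factors of the hook ratio, those of the rows
    above r carry an additional q^(-2); together these compensate the
    increase of eta, which is r. *)
Lemma part_weight_addbox n (l l' : seq nat) (r : 'I_n) :
  size l = n -> size l' = n -> sorted geq l -> sorted geq l' ->
  (forall j, nth 0%N l' j = nth 0%N l j + (j == r))%N ->
  part_weight l'
  = hook_ratio (q ^+ 2) (fun i : 'I_n => box_param n (nth 0%N l i) i) r
    * part_weight l.
Proof.
move=> sz sz' sl sl' l'E; set x := (fun i : 'I_n => _).
have xinj : injective x by exact: box_param_inj.
have x0 i : x i != 0 by rewrite expf_neq0.
pose b l (i : 'I_n) := beta_number l i.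
pose D l (i j : 'I_n) := qint q (b l i - b l j).
have DP m := @part_weight_beta n m.
have bE (i : 'I_n) : x i = q ^+ (2 * b l i).
  by rewrite /x /box_param /b /beta_number sz.
have b'E (i : 'I_n) : b l' i = (b l i + (i == r))%N.
  by rewrite /b /beta_number l'E sz sz' addnAC.
have bdec m (i j : 'I_n) : size m = n -> sorted geq m -> (i < j)%N ->
    (b m j < b m i)%N.
  move=> zm sm ij; have := ltn_ord j; have := @nth_sorted_geq m i j sm.
  by rewrite /b /beta_number; lia.
have Q1 : q ^+ 2 - 1 != 0 by rewrite subr_eq0 q_gen.
have etaE : eta_part l' = (eta_part l + r)%N.
  rewrite /eta_part sz sz'.
  under eq_bigr do rewrite l'E mulnDr.
  rewrite big_split /=; congr (_ + _)%N.
  rewrite (bigD1 r) //= eqxx muln1 big1 ?addn0 // => i ir.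
  by rewrite [nat_of_ord i == _](negPf ir) muln0.
pose P (p : pred 'I_n) := \prod_(j < n | p j)
  ((q ^+ 2 * x r - x j) / (x r - x j)).
have xd (j : 'I_n) : j != r -> x r - x j != 0.
  by move=> jr; rewrite subr_eq0 (inj_eq xinj) eq_sym.
have EA : \prod_(j < n | (r < j)%N) D l' r j
    = \prod_(j < n | (r < j)%N) D l r j * P (fun j => (r < j)%N).
  rewrite -big_split /=; apply: eq_bigr => j rj.
  have jr : j != r by apply: contraTneq rj => ->; rewrite ltnn.
  have h1 := bdec _ _ _ sz sl rj; have h2 := bdec _ _ _ sz' sl' rj.
  rewrite /D !qintB 1?ltnW // !b'E eqxx (negPf jr) addn0 mulnDr exprD -!bE.
  by have := xd _ jr; have := x0 j => *; field; apply/and3P.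
(* Each row above r takes up one factor q^2 of q^(2 r). *)
have EB : q ^+ (2 * r) * \prod_(i < n | (i < r)%N) D l' i r
    = \prod_(i < n | (i < r)%N) D l i r * P (fun i => (i < r)%N).
  have -> : q ^+ (2 * r) = \prod_(i < n | (i < r)%N) q ^+ 2.
    rewrite prodr_const exprM; congr (_ ^+ _).
    by rewrite -sum1_card (big_ord_narrow (ltnW (ltn_ord r))) sum1_card
      card_ord.
  rewrite -!big_split /=; apply: eq_bigr => i ir'.
  have ir : i != r by apply: contraTneq ir' => ->; rewrite ltnn.
  have h1 := bdec _ _ _ sz sl ir'; have h2 := bdec _ _ _ sz' sl' ir'.
  rewrite /D !qintB 1?ltnW // !b'E eqxx (negPf ir) addn0 mulnDr exprD -!bE.
  by have := xd _ ir; have := x0 r => *; field; apply/and4P.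
have EC : \prod_(i < n | i != r) \prod_(j < n | (i < j)%N && (j != r)) D l' i j
    = \prod_(i < n | i != r) \prod_(j < n | (i < j)%N && (j != r)) D l i j.
  apply: eq_bigr => i ir; apply: eq_bigr => j /andP[_ jr].
  by rewrite /D !b'E (negPf ir) (negPf jr) !addn0.
have EF : \prod_(i < n) \prod_(h < b l' i) qint q h.+1
    = \prod_(i < n) \prod_(h < b l i) qint q h.+1
      * ((q ^+ 2 * x r - 1) / (q ^+ 2 - 1)).
  rewrite (bigD1 r) //= [in RHS](bigD1 r) //= b'E eqxx addn1 big_ord_recr /=.
  rewrite [qint q (b l r).+1](_ : _ = (q ^+ 2 * x r - 1) / (q ^+ 2 - 1));
    last first.
    by rewrite bE -exprD /qint mulnS.
  rewrite mulrAC; congr (_ * _ * _); apply: eq_bigr => i ir.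
  by rewrite b'E (negPf ir) addn0.
rewrite !DP // EF !(prod_pairs _ r) EC EA etaE mulnDr exprD.
rewrite /hook_ratio.
have -> : \prod_(j < n | j != r) ((q ^+ 2 * x r - x j) / (x r - x j))
    = P (fun j => (r < j)%N) * P (fun j => (j < r)%N).
  rewrite (bigID (fun j : 'I_n => (r < j)%N)) /=; congr (_ * _).
    by apply: eq_bigl => j; rewrite -val_eqE /=; lia.
  by apply: eq_bigl => j; rewrite -val_eqE /=; lia.
have Qx1 : q ^+ 2 * x r - 1 != 0.
  by rewrite bE -exprD subr_eq0 q_gen.
have F0 : \prod_(i < n) \prod_(h < b l i) qint q h.+1 != 0.
  by do 2![apply/prodf_neq0 => ? _]; rewrite qint_neq0.
move: EB F0; set F := \prod_(i < n) _; set A := \prod_(j < n | _) D l r j.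
set B := \prod_(i < n | _) D l i r; set B' := \prod_(i < n | _) D l' i r.
set C := \prod_(i < n | i != r) _; set PA := P _; set PB := P _ => EB F0.
transitivity (q ^+ (2 * eta_part l) * (A * PB * (q ^+ (2 * r) * B') * C)
  / (F * ((q ^+ 2 * x r - 1) / (q ^+ 2 - 1)))).
  by congr (_ / _); ring.
by rewrite EB; field; apply/and3P.
Qed.
End AddBox.

(** * Lattice words *)

Section LatticeWords.

Variables (d n : nat).
Local Notation letter := ('I_d * 'I_n)%type.
Implicit Types (w u v : seq letter) (a b : letter).

Definition dominant w : bool :=
  [forall k : 'I_d, forall r1 : 'I_n, forall r2 : 'I_n, (r1 <= r2)%N ==>
     (count_mem (k, r2) w <= count_mem (k, r1) w)%N].

Lemma dominantP w :
  reflect (forall (k : 'I_d) (r1 r2 : 'I_n), (r1 <= r2)%N ->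
             (count_mem (k, r2) w <= count_mem (k, r1) w)%N)
          (dominant w).
Proof.
apply: (iffP forallP) => [H k r1 r2|H k].
  by have /forallP/(_ r1)/forallP/(_ r2)/implyP := H k.
by do 2![apply/forallP => ?]; apply/implyP; exact: H.
Qed.

Lemma perm_dominant w v : perm_eq w v -> dominant w = dominant v.
Proof.
move=> /seq.permP wv; apply: eq_forallb => k; apply: eq_forallb => r1.
by apply: eq_forallb => r2; rewrite !wv.
Qed.

(** The word of a d-tableau lists the (position, row) of its entries. The
    tableau is standard when its entries fill the rows from left to right
    and all prefixes of the word have row counts that are partitions. *)
Definition lattice w : bool :=
  all (fun m => dominant (take m w)) (iota 0 (size w).+1).

Lemma lattice_rcons w a :
  lattice (rcons w a) = lattice w && dominant (rcons w a).
Proof.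
rewrite /lattice size_rcons -[(size w).+2]addn1 iotaD all_cat [X in _ && X]/=
  andbT; congr (_ && _).
    apply: eq_in_all => m; rewrite mem_iota ltnS => /= mw.
  by rewrite -cats1 takel_cat.
by rewrite take_oversize ?size_rcons.
Qed.

Lemma lattice0 : lattice [::].
Proof. by rewrite /lattice /= andbT; apply/dominantP. Qed.

Lemma lattice_dominant w : lattice w -> dominant w.
Proof.
elim/last_ind: w => [_|w a _]; first exact/dominantP.
by rewrite lattice_rcons => /andP[].
Qed.

Lemma lattice_take m w : lattice w -> lattice (take m w).
Proof.
elim/last_ind: w => [//|w a IH]; have [wm|mw] := leqP (size w).+1 m.
  by rewrite take_oversize ?size_rcons.
by rewrite lattice_rcons => /andP[/IH]; rewrite -cats1 takel_cat.
Qed.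

Definition row_counts (k : 'I_d) w : seq nat :=
  [seq count_mem (k, r) w | r <- enum 'I_n].

Lemma size_row_counts k w : size (row_counts k w) = n.
Proof. by rewrite size_map size_enum_ord. Qed.

Lemma nth_row_counts k w (r : 'I_n) :
  nth 0%N (row_counts k w) r = count_mem (k, r) w.
Proof. by rewrite (nth_map r) ?size_enum_ord // nth_ord_enum. Qed.

Lemma sorted_row_counts k w : dominant w -> sorted geq (row_counts k w).
Proof.
move=> /dominantP dw; rewrite sorted_map.
apply: (@sub_sorted _ (relpre val leq)); first by move=> r1 r2 /=; exact: dw.
by rewrite -sorted_map val_enum_ord iota_sorted.
Qed.

Lemma row_counts_rcons k w a (j : nat) :
  nth 0%N (row_counts k (rcons w a)) j
  = (nth 0%N (row_counts k w) j + ((k == a.1) && (j == a.2)))%N.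
Proof.
have [jn|nj] := ltnP j n; last first.
  rewrite !nth_default ?size_row_counts //.
  by rewrite [j == _]gtn_eqF ?andbF // (leq_trans _ nj).
rewrite (_ : j = Ordinal jn) // !nth_row_counts -cats1 count_cat /= addn0.
by congr (_ + nat_of_bool _)%N; rewrite [a in LHS]surjective_pairing eq_sym.
Qed.

Fixpoint words m : seq (seq letter) :=
  if m is m'.+1 then [seq rcons w a | w <- words m', a <- enum {: letter}]
  else [:: [::]].

Lemma mem_words m w : (w \in words m) = (size w == m).
Proof.
elim: m w => [|m IH] w /=; first by rewrite inE size_eq0.
apply/allpairsP/eqP => [[[v a] [/=]]|].
  by rewrite IH => /eqP sv _ ->; rewrite size_rcons sv.
case/lastP: w => // w a; rewrite size_rcons => -[sS].
by exists (w, a); rewrite IH sS eqxx mem_enum.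
Qed.

Lemma uniq_words m : uniq (words m).
Proof.
elim: m => [//|m IH] /=; apply: allpairs_uniq; rewrite ?enum_uniq //.
by move=> [w a] [v b] _ _ /= /rcons_inj[-> ->].
Qed.

Lemma big_words_rcons (V : nmodType) m (F : seq letter -> V) :
  \sum_(w <- words m.+1) F w
  = \sum_(w <- words m) \sum_(a : letter) F (rcons w a).
Proof.
rewrite /= big_allpairs_dep; apply: eq_bigr => w _.
by rewrite big_enum.
Qed.

(** Letters i and i + 1 are exchanged; take and drop avoid a default letter. *)
Definition swap i w : seq letter :=
  take i w ++ rev (take 2 (drop i w)) ++ drop i.+2 w.

Lemma swap_cat u a b v : swap (size u) (u ++ a :: b :: v) = u ++ b :: a :: v.
Proof.
rewrite /swap take_size_cat // drop_size_cat //; congr (_ ++ _).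
by rewrite drop_cat ltnNge (leq_trans (leqnSn _)) //= -addn2 addKn /= take0
  drop0.
Qed.

Lemma split_word i w : (i.+1 < size w)%N ->
  exists u a b v, w = u ++ a :: b :: v /\ size u = i.
Proof.
move=> iS; exists (take i w).
case E: (drop i w) => [|a [|b v]].
- by have := size_drop i w; rewrite E /=; lia.
- by have := size_drop i w; rewrite E /=; lia.
- by exists a, b, v; rewrite -E cat_take_drop size_takel //; lia.
Qed.

Lemma perm_swap i w : perm_eq (swap i w) w.
Proof.
rewrite -[X in perm_eq _ X](cat_take_drop i) perm_cat2l.
rewrite -[X in perm_eq _ X](cat_take_drop 2) perm_cat ?perm_rev //.
by rewrite drop_drop.
Qed.

Lemma swap_rcons i w a : (i.+1 < size w)%N ->
  swap i (rcons w a) = rcons (swap i w) a.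
Proof.
move=> /split_word[u [b [c [v [-> <-]]]]].
by rewrite swap_cat !rcons_cat /= swap_cat.
Qed.

End LatticeWords.

(** * Transition weights of lattice words *)

Section Weights.

Variables (K : fieldType) (q : K) (d n : nat).
Local Notation letter := ('I_d * 'I_n)%type.
Implicit Types (w u v : seq letter) (a b : letter).

Definition letter_param w a : K :=
  box_param q n (nth 0%N (row_counts a.1 w) a.2) a.2.

Lemma letter_paramE w a : letter_param w a = box_param q n (count_mem a w) a.2.
Proof. by rewrite /letter_param nth_row_counts -surjective_pairing. Qed.

(** The transition weight of the growth process from the shape of w to the
    shape with one more box. *)
Definition step_weight w a : K :=
  d%:R^-1 * hook_ratio (q ^+ 2) (fun i => letter_param w (a.1, i)) a.2.

(** The prefix v already read is an argument because the weight of a step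
    depends on the shape reached so far. *)
Fixpoint path_weight_from v w : K :=
  if w is a :: w' then step_weight v a * path_weight_from (rcons v a) w' else 1.

Definition path_weight w : K := path_weight_from [::] w.

Lemma path_weight_rcons w a :
  path_weight (rcons w a) = path_weight w * step_weight w a.
Proof.
rewrite /path_weight -[w in step_weight w a]cat0s.
elim: w [::] => [|b w IH] v /=; first by rewrite cats0 mulr1 mul1r.
by rewrite IH mulrA cat_rcons.
Qed.

Lemma row_counts_perm k w v : perm_eq w v -> row_counts k w = row_counts k v.
Proof. by move=> /seq.permP wv; apply: eq_map => r; rewrite wv. Qed.

Lemma step_weight_perm w v a : perm_eq w v -> step_weight w a = step_weight v a.
Proof.
by move=> wv; rewrite /step_weight /letter_param /= (row_counts_perm _ wv).
Qed.

(** A box breaks dominance when its row is as long as the row above; the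
    factor of the hook ratio for that row is then 0. *)
Lemma step_weight_eq0 w a : dominant w -> ~~ dominant (rcons w a) ->
  step_weight w a = 0.
Proof.
case: a => k r /dominantP dw; have [r0|r_gt0] := posnP r.
  case/negP; apply/dominantP => k' r1 r2 r12; rewrite -cats1 !count_cat /=.
  rewrite !addn0; have := dw k' r1 r2 r12.
  case: eqP => [[-> r2E]|_] /=; last by lia.
  case: eqP => [_|[]]; first by lia.
  by rewrite -r2E r0 in r12 *; congr pair; apply/val_inj => /=; lia.
have rn : (r.-1 < n)%N by rewrite (leq_ltn_trans (leq_pred _)).
(* If row r is shorter than row r - 1, adding the box keeps dominance. *)
pose r' := Ordinal rn; have r'E : r' = r.-1 :> nat by [].
have [E _|E] := eqVneq (count_mem (k, r') w) (count_mem (k, r) w).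
  rewrite /step_weight /hook_ratio (bigD1 r') /=; last first.
    by rewrite -val_eqE /=; lia.
  rewrite [_ * _ - letter_param w (k, r')](_ : _ = 0) ?mul0r ?mulr0 //;
    apply/eqP; rewrite subr_eq0.
  apply/eqP; rewrite !letter_paramE /box_param /= E -exprD; congr (_ ^+ _).
  by have := ltn_ord r; move: (count_mem _ _) => c; lia.
case/negP; apply/dominantP => k' r1 r2 r12; rewrite -cats1 !count_cat /= !addn0.
have := dw k' r1 r2 r12.
case: eqP => [[kE r2E]|_] /=; last by lia.
case: eqP => [_|r1E]; first by lia.
rewrite -kE -r2E in r12 r1E *.
have : (r1 <= r')%N.
  rewrite /=; have : (r1 != r :> nat); last by lia.
  by apply/eqP => /val_inj r1r; apply: r1E; rewrite r1r.
move=> /(dw k); have := dw k r' r; rewrite /= leq_pred => /(_ isT).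
move/eqP: E; move: (count_mem (k, r') w) (count_mem (k, r1) w)
  (count_mem (k, r) w).
by move=> x y z; lia.
Qed.

Lemma path_weight_eq0 w : ~~ lattice w -> path_weight w = 0.
Proof.
elim/last_ind: w => [|w a IH]; first by rewrite lattice0.
rewrite lattice_rcons negb_and path_weight_rcons.
have [lw /= H|/IH -> _] := boolP (lattice w); last by rewrite mul0r.
by rewrite (step_weight_eq0 (lattice_dominant lw) H) mulr0.
Qed.

Hypotheses (q_neq0 : q != 0) (q_gen : forall m, (0 < m)%N -> q ^+ m != 1).

Lemma letter_param_inj w k : dominant w ->
  injective (fun i => letter_param w (k, i)).
Proof.
move=> dw; apply: (box_param_inj q_neq0 q_gen (size_row_counts k w)).
exact: sorted_row_counts.
Qed.

Lemma letter_param_neq0 w a : letter_param w a != 0.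
Proof. exact: expf_neq0. Qed.

Lemma letter_param_neq1 w a : q ^+ 2 * letter_param w a != 1.
Proof. by rewrite -exprD -mulnS q_gen. Qed.

Lemma part_weight0 k : part_weight q (row_counts k ([::] : seq letter)) = 1.
Proof.
have E (j : nat) : nth 0%N (@row_counts d n k [::]) j = 0%N.
  have [jn|nj] := ltnP j n; last by rewrite nth_default ?size_row_counts.
  by rewrite (_ : j = Ordinal jn) // nth_row_counts.
rewrite /part_weight /eta_part big1 => [|i _]; last by rewrite E muln0.
rewrite expr0 big1 ?invr1 ?mulr1 // => i _.
by apply: big1 => -[c cl] _; exfalso; rewrite E in cl.
Qed.

(** The hook ratios telescope, starting from the empty d-partition. *)
Lemma path_weight_lattice w : lattice w ->
  path_weight w
  = d%:R ^- size w * \prod_(k < d) part_weight q (row_counts k w).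
Proof.
elim/last_ind: w => [_|w a IH].
  by rewrite expr0 invr1 mul1r big1 // => k _; exact: part_weight0.
rewrite lattice_rcons => /andP[lw dwa]; have dw := lattice_dominant lw.
rewrite path_weight_rcons IH // size_rcons exprS invfM.
rewrite (bigD1 a.1) //= [in RHS](bigD1 a.1) //=.
have -> : part_weight q (row_counts a.1 (rcons w a)) =
    hook_ratio (q ^+ 2) (fun i => letter_param w (a.1, i)) a.2
    * part_weight q (row_counts a.1 w).
  apply: (part_weight_addbox q_neq0 q_gen); rewrite ?size_row_counts //.
  - exact: sorted_row_counts.
  - exact: sorted_row_counts.
  - by move=> j; rewrite row_counts_rcons eqxx.
have -> : \prod_(k < d | k != a.1) part_weight q (row_counts k (rcons w a))
    = \prod_(k < d | k != a.1) part_weight q (row_counts k w).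
  apply: eq_bigr => k ka; congr (part_weight q _).
  apply: (@eq_from_nth _ 0%N) => [|j _]; first by rewrite !size_row_counts.
  by rewrite row_counts_rcons (negPf ka) addn0.
by rewrite /step_weight; ring.
Qed.

Lemma sum_count_letters w : (\sum_(a : letter) count_mem a w = size w)%N.
Proof.
elim: w => [|b w IH] /=; first by rewrite big1.
rewrite big_split /= IH (bigD1 b) //= eqxx big1 // => a ab.
by rewrite eq_sym (negPf ab).
Qed.

(** A partition of fewer than n boxes cannot have n non-empty rows. *)
Lemma last_row_param w (z : 'I_n) k : lattice w -> (size w < n)%N ->
  z = n.-1 :> nat -> letter_param w (k, z) = 1.
Proof.
move=> lw wn zE; rewrite letter_paramE /box_param /= zE subnn addn0.
suff -> : count_mem (k, z) w = 0%N by [].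
apply/eqP; rewrite -leqn0 leqNgt; apply/negP => c0.
have n_le : (n <= \sum_(r < n) count_mem (k, r) w)%N.
  rewrite -[X in (X <= _)%N]card_ord -sum1_card; apply: leq_sum => r _.
  apply: leq_trans c0 _; have /dominantP := lattice_dominant lw; apply.
  by rewrite zE -ltnS prednK // (leq_ltn_trans _ (ltn_ord r)).
move: wn; rewrite ltnNge => /negP; apply; apply: leq_trans n_le _.
rewrite -sum_count_letters (eq_bigr (fun a : letter => count_mem (a.1, a.2) w)).
  rewrite -(pair_bigA _ (fun k r => count_mem (k, r) w)) /= (bigD1 k) //=.
  exact: leq_addr.
by case.
Qed.

Lemma sum_letters (F : letter -> K) : \sum_a F a = \sum_k \sum_r F (k, r).
Proof.
by rewrite (pair_bigA _ (fun k r => F (k, r))); apply: eq_bigr => -[].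
Qed.

Lemma sum_step_weight w k : lattice w -> (size w < n)%N ->
  \sum_(r < n) step_weight w (k, r) = d%:R^-1.
Proof.
move=> lw wn; have n1 : (n.-1 < n)%N by lia.
rewrite /step_weight /= -mulr_sumr.
rewrite (@sum_hook_ratio _ _ _ _ (Ordinal n1)) ?mulr1 //.
- exact/letter_param_inj/lattice_dominant.
- by move=> r; exact: (letter_param_neq0 w (k, r)).
- by move=> r; exact: (letter_param_neq1 w (k, r)).
- exact: (last_row_param (z := Ordinal n1)).
Qed.

(** The letter b has just been placed, so its box is removable and its
    content differs from the contents of all boxes that can be added. *)
Lemma sum_step_weight_content w b : lattice (rcons w b) ->
  ((size w).+1 < n)%N ->
  \sum_(r < n) step_weight (rcons w b) (b.1, r)
     * (letter_param (rcons w b) (b.1, r)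
        / (letter_param (rcons w b) (b.1, r) - letter_param w b)) = 0.
Proof.
move=> lwb wn; have n1 : (n.-1 < n)%N by lia.
have [lw dwb] : lattice w /\ dominant (rcons w b).
  by move: lwb; rewrite lattice_rcons => /andP.
have Q0 : q ^+ 2 != 0 by rewrite expf_neq0.
have bE : letter_param (rcons w b) (b.1, b.2) = q ^+ 2 * letter_param w b.
  rewrite !letter_paramE -cats1 count_cat /= -surjective_pairing eqxx.
  by rewrite /box_param addn0 addnAC -exprD -mulnS addn1.
have -> : letter_param w b = letter_param (rcons w b) (b.1, b.2) / q ^+ 2.
  by rewrite bE mulrC mulKf.
under eq_bigr do rewrite /step_weight -mulrA.
rewrite -mulr_sumr.
have lz v : lattice v -> (size v < n)%N -> letter_param v (b.1, Ordinal n1) = 1.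
  by move=> lv vn; exact: last_row_param.
rewrite (@sum_hook_ratio_content _ _ _ _ (Ordinal n1)) ?mulr0 //.
- exact: letter_param_inj.
- by move=> r; exact: (letter_param_neq0 _ (b.1, r)).
- by move=> r; exact: (letter_param_neq1 _ (b.1, r)).
- by apply: lz => //; rewrite size_rcons.
- apply/eqP => bz; have := lz _ lwb;
  rewrite size_rcons -{1}bz bE => /(_ wn)/eqP.
  exact/negP/letter_param_neq1.
- move=> r; rewrite bE (inj_eq (mulfI Q0)); apply/eqP => rb.
  have [rE|rE] := eqVneq r b.2.
    move: rb; rewrite rE bE => /eqP.
    rewrite -[X in _ == X]mul1r (inj_eq (mulIf (letter_param_neq0 _ _))).
    by apply/negP; exact: q_gen.
  have bF : (b == (b.1, r)) = false by apply: contraNF rE => /eqP ->.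
  case/eqP: rE; apply: (letter_param_inj (k := b.1) (lattice_dominant lw)).
  rewrite -surjective_pairing -rb !letter_paramE -cats1 count_cat /= addn0.
  by rewrite bF addn0.
Qed.

End Weights.

(** * Normal words of the symmetric group *)

Section NormalWords.

Implicit Types (m l i : nat) (v : seq nat).

(** The word m - 1, m - 2, ..., m - l, in the numbering of the generators
    from 0. These runs are the minimal representatives of the cosets of S_m
    in S_(m+1). *)
Definition down m l : seq nat := rev (iota (m - l) l).

Inductive normal_word : nat -> seq nat -> Prop :=
| NormalWord0 : normal_word 0 [::]
| NormalWordS m v l : normal_word m v -> (l <= m)%N ->
    normal_word m.+1 (v ++ down m l).

Lemma downS m l : (l < m)%N -> down m l.+1 = m.-1 :: down m.-1 l.
Proof.
move=> lm; rewrite /down -addn1 iotaD rev_cat /= addn1.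
have -> : (m - l.+1 = m.-1 - l)%N by lia.
by have -> : (m.-1 - l + l = m.-1)%N by lia.
Qed.

Lemma down_rcons m l : (l < m)%N -> down m l.+1 = rcons (down m l) (m - l.+1)%N.
Proof.
by move=> lm; rewrite /down /= rev_cons subnSK.
Qed.

Lemma mem_down m l i : (l <= m)%N -> (i \in down m l) = (m - l <= i < m)%N.
Proof. by move=> lm; rewrite mem_rev mem_iota subnK. Qed.

Lemma normal_word_bound m v : normal_word m v -> all (fun i => i.+1 < m)%N v.
Proof.
elim=> [//|{}m {}v l _ IH lm]; rewrite all_cat; apply/andP; split.
  by apply: sub_all IH => i; lia.
by apply/allP => i; rewrite mem_down //; lia.
Qed.

End NormalWords.

(** * Weighted traces of seminormal matrices *)

Section SeminormalCoefficients.

Variables (K : fieldType) (q : K) (d n : nat).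
Local Notation letter := ('I_d * 'I_n)%type.
Implicit Types (w u v : seq letter) (a b : letter) (s : seq nat) (i m : nat).
Local Notation x := (letter_param q).

(** The coefficient of v_T in g_i v_T, in terms of the word of T. Contents
    are replaced by the parameters of the letters, which are proportional to
    them. *)
Definition diag_coef i w : K :=
  if drop i w is a :: b :: _ then
    if a.1 == b.1 then
      x (rcons (take i w) a) b * (q - q^-1)
      / (x (rcons (take i w) a) b - x (take i w) a)
    else 0
  else 0.

(** The coefficient of the exchanged tableau in g_i v_T. *)
Definition off_coef i w : K :=
  if drop i w is a :: b :: _ then
    if a.1 == b.1 then
      (q * x (rcons (take i w) a) b - q^-1 * x (take i w) a)
      / (x (rcons (take i w) a) b - x (take i w) a)
    else 1
  else 0.

Definition swappable i w : bool := (swap i w != w) && lattice (swap i w).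

(** The matrix coefficient, in the tableau basis, of the product of the g_i
    for i in s. It is defined for words w and v of any length, which allows
    an induction on the number of entries. *)
Fixpoint coef s w v : K :=
  if s is i :: s' then
    diag_coef i w * coef s' w v
    + (if swappable i w then off_coef i (swap i w) * coef s' (swap i w) v else
      0)
  else (w == v)%:R.

Lemma take_drop_rcons i w a : (i.+1 < size w)%N ->
  exists u b c v, [/\ take i w = u, drop i w = b :: c :: v,
    take i (rcons w a) = u & drop i (rcons w a) = b :: c :: rcons v a].
Proof.
move=> /split_word[u [b [c [v [-> <-]]]]]; exists u, b, c, v.
by rewrite rcons_cat /= !take_size_cat // !drop_size_cat.
Qed.

Lemma diag_coef_rcons i w a : (i.+1 < size w)%N ->
  diag_coef i (rcons w a) = diag_coef i w.
Proof.
by rewrite /diag_coef => /(take_drop_rcons a)[u [b [c [v [-> -> -> ->]]]]].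
Qed.

Lemma off_coef_rcons i w a : (i.+1 < size w)%N ->
  off_coef i (rcons w a) = off_coef i w.
Proof.
by rewrite /off_coef => /(take_drop_rcons a)[u [b [c [v [-> -> -> ->]]]]].
Qed.

Lemma size_swap i w : size (swap i w) = size w.
Proof. exact/perm_size/perm_swap. Qed.

Lemma swappable_rcons i w a : (i.+1 < size w)%N -> lattice (rcons w a) ->
  swappable i (rcons w a) = swappable i w.
Proof.
move=> iw; rewrite /swappable swap_rcons // eqseq_rcons eqxx andbT.
rewrite !lattice_rcons => /andP[_ dwa]; congr (_ && _).
by rewrite (perm_dominant (v := rcons w a)) ?dwa ?andbT // -!cats1 perm_cat2r
  perm_swap.
Qed.

Lemma coef_neq0 s w v : coef s w v != 0 ->
  perm_eq w v /\ (lattice w -> lattice v).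
Proof.
elim: s w => [|i s IH] w /=.
  by case: (w =P v) => [-> //|_]; rewrite eqxx.
have [-> |cwv _] := eqVneq (coef s w v) 0; last exact: IH.
rewrite mulr0 add0r; case: ifP => [/andP[_ lw]|_]; last by rewrite eqxx.
have [-> |cwv _] := eqVneq (coef s (swap i w) v) 0.
  by rewrite mulr0 eqxx.
have [pw lv] := IH _ cwv; split=> [|_]; last exact: lv.
by apply: perm_trans pw; rewrite perm_sym perm_swap.
Qed.

(** Generators that do not involve the last entry act as if it were absent. *)
Lemma coef_rcons s w v a b : all (fun i => i.+1 < size w)%N s ->
  lattice (rcons w a) ->
  coef s (rcons w a) (rcons v b) = (a == b)%:R * coef s w v.
Proof.
elim: s w => [|i s IH] w /=.
  by move=> _ _; rewrite eqseq_rcons andbC -mulnb natrM.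
move=> /andP[iw sw] lwa; rewrite diag_coef_rcons // swappable_rcons // IH //.
rewrite mulrDr mulrCA; congr (_ + _).
case: ifP => [|_]; last by rewrite mulr0.
rewrite -(swappable_rcons iw lwa) => /andP[_]; rewrite swap_rcons // => l'.
by rewrite off_coef_rcons ?size_swap // IH ?size_swap // mulrCA.
Qed.

Lemma coef_cat s s' w v :
  coef (s ++ s') w v
  = \sum_(u <- words d n (size w)) coef s w u * coef s' u v.
Proof.
elim: s w => [|i s IH] w /=.
  have wI : w \in words d n (size w) by rewrite mem_words.
  rewrite (bigD1_seq w) ?uniq_words //= eqxx mul1r big1 ?addr0 // => u /negPf
    uw.
  by rewrite eq_sym uw mul0r.
rewrite !IH mulr_sumr size_swap; case: ifP => _; last first.
  by rewrite addr0; apply: eq_bigr => u _; rewrite addr0 mulrA.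
rewrite mulr_sumr -big_split; apply: eq_bigr => u _ /=.
by rewrite mulrDl !mulrA.
Qed.

Hypotheses (q_neq0 : q != 0) (q_gen : forall m, (0 < m)%N -> q ^+ m != 1).
Hypothesis d_neq0 : d%:R != 0 :> K.
Variable xi : 'I_d -> K.
Hypothesis sum_xi : forall j, (j < d)%N ->
  \sum_k xi k ^+ j = d%:R *+ (j == 0%N).

Definition t_weight (k : nat -> nat) w : K :=
  \prod_(ai <- zip w (iota 0 (size w))) xi ai.1.1 ^+ k ai.2.

Lemma t_weight_rcons k w a :
  t_weight k (rcons w a) = t_weight k w * xi a.1 ^+ k (size w).
Proof.
rewrite /t_weight size_rcons -[(size w).+1]addn1 iotaD /= cats1 add0n.
by rewrite zip_rcons ?size_iota // big_rcons /= mulrC.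
Qed.

Definition word_trace m (k : nat -> nat) s : K :=
  \sum_(w <- words d n m) path_weight q w * t_weight k w * coef s w w.

(** Summing over the letters of the last entry gives a power sum of the
    roots xi, since all positions have the same total transition weight. *)
Lemma word_trace_restrict m k s : (m < n)%N -> (k m < d)%N ->
  all (fun i => i.+1 < m)%N s ->
  word_trace m.+1 k s = word_trace m k s *+ (k m == 0%N).
Proof.
move=> mn km sm; rewrite /word_trace big_words_rcons -sumrMnl.
rewrite big_seq [RHS]big_seq; apply: eq_bigr => w; rewrite mem_words => /eqP wm.
have [lw|nlw] := boolP (lattice w); last first.
  rewrite (path_weight_eq0 q nlw) !mul0r mul0rn big1 // => a _.
  by rewrite path_weight_rcons (path_weight_eq0 q nlw) !mul0r.
transitivity (\sum_a path_weight q w * t_weight k w * coef s w w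
    * (step_weight q w a * xi a.1 ^+ k m)).
  apply: eq_bigr => a _; rewrite path_weight_rcons t_weight_rcons wm.
  have [lwa|nlwa] := boolP (lattice (rcons w a)).
    by rewrite coef_rcons ?wm // eqxx mul1r; ring.
  rewrite lattice_rcons lw /= in nlwa.
  by rewrite (step_weight_eq0 q (lattice_dominant lw) nlwa) !(mul0r, mulr0).
rewrite -mulr_sumr; suff -> :
  \sum_(a : letter) step_weight q w a * xi a.1 ^+ k m
    = 1 *+ (k m == 0%N) by rewrite mulrnAr mulr1.
rewrite sum_letters /=.
under eq_bigr => c _ do rewrite -mulr_suml sum_step_weight // ?wm //.
by rewrite -mulr_sumr sum_xi // mulrnAr mulVf.
Qed.

(** Only the rows in the position of b contribute, as the diagonal
    coefficient of two entries in different positions is 0. *)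
Lemma sum_step_weight_diag_coef w b j : lattice (rcons w b) ->
  ((size w).+1 < n)%N ->
  \sum_a step_weight q (rcons w b) a * xi a.1 ^+ j
     * diag_coef (size w) (rcons (rcons w b) a) = 0.
Proof.
move=> lwb wn; apply: etrans (sum_letters _) _;
  rewrite (bigD1 b.1) //= [X in _ + X]big1 ?addr0.
  have /(congr1 ( *%R (xi b.1 ^+ j * (q - q^-1)))) :=
    sum_step_weight_content q_neq0 q_gen lwb wn.
  rewrite mulr0 mulr_sumr => {2}<-.
  apply: eq_bigr => r _; rewrite /diag_coef -!cats1 -catA /=.
  by rewrite drop_size_cat // take_size_cat //= eqxx -cats1; ring.
move=> k kb; apply: big1 => r _; rewrite /diag_coef -!cats1 -catA /=.
by rewrite drop_size_cat //= eq_sym (negPf kb) mulr0.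
Qed.

(** The generators of s and s' leave the last entry in place, so the only
    generator that could move it is m, and it has to act by its diagonal
    coefficient. This coefficient depends on the last entry only through its
    letter, and its average over these letters is 0. *)
Lemma word_trace_crossing m k s s' : (m.+1 < n)%N ->
  all (fun i => i.+1 < m.+1)%N s -> all (fun i => i.+1 < m.+1)%N s' ->
  word_trace m.+2 k (s ++ m :: s') = 0.
Proof.
move=> mn sm s'm; rewrite /word_trace big_words_rcons.
rewrite big_seq big1 // => w; rewrite mem_words => /eqP wm.
pose F u a := path_weight q w * t_weight k w * coef s w u * coef s' u w
    * (step_weight q w a * xi a.1 ^+ k m.+1 * diag_coef m (rcons u a)).
have [lw|nlw] := boolP (lattice w); last first.
  by apply: big1 => a _; rewrite path_weight_rcons (path_weight_eq0 q nlw)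
    !mul0r.
transitivity (\sum_a \sum_(u <- words d n m.+1) F u a).
  apply: eq_bigr => a _; rewrite path_weight_rcons t_weight_rcons wm /F.
  have [lwa|nlwa] := boolP (lattice (rcons w a)); last first.
    rewrite lattice_rcons lw /= in nlwa.
    rewrite (step_weight_eq0 q (lattice_dominant lw) nlwa) !(mul0r, mulr0).
    by rewrite big1 // => u _; rewrite !(mul0r, mulr0).
  rewrite coef_cat size_rcons wm big_words_rcons mulr_sumr.
  rewrite big_seq [RHS]big_seq; apply: eq_bigr => u;
    rewrite mem_words => /eqP um.
  rewrite (bigD1 a) // [X in _ * (_ + X)]big1 => [|b /andP[_ ba]]; last first.
    by rewrite coef_rcons ?wm // eq_sym (negPf ba) !mul0r.
  rewrite addr0 coef_rcons ?wm // eqxx mul1r.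
  have [-> |cwu] := eqVneq (coef s w u) 0; first by rewrite !(mul0r, mulr0).
  have [pwu lu] := coef_neq0 cwu.
  have lua : lattice (rcons u a).
    rewrite lattice_rcons lu //= (perm_dominant (v := rcons w a)).
      exact: lattice_dominant.
    by rewrite -!cats1 perm_cat2r perm_sym.
  rewrite /= coef_rcons ?um // eqxx mul1r.
  (* An exchange would change the last letter, which the remaining
     generators keep; so the coefficient back to the letter a is 0. *)
  have -> : (if swappable m (rcons u a) then off_coef m (swap m (rcons u a))
      * coef s' (swap m (rcons u a)) (rcons w a) else 0) = 0.
    case: ifP => // /andP[]; case/lastP: u um {cwu pwu lu lua} => // u b.
    have E c e : rcons (rcons u c) e = u ++ [:: c; e] by rewrite -!cats1 -catA.
    rewrite size_rcons => -[um]; rewrite E -um swap_cat -!E um => sw lsw.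
    rewrite coef_rcons ?size_rcons ?um //.
    case: (b =P a) => [ba|_]; last by rewrite mul0r mulr0.
    by rewrite ba eqxx in sw.
  by rewrite addr0; ring.
rewrite exchange_big big_seq big1 // => u; rewrite mem_words => /eqP um.
rewrite -mulr_sumr.
have [-> |cwu] := eqVneq (coef s w u) 0; first by rewrite !(mul0r, mulr0).
have [pwu /(_ lw) lu] := coef_neq0 cwu.
under eq_bigr do rewrite (step_weight_perm _ _ pwu).
case/lastP: u um lu {cwu pwu} => // u b; rewrite size_rcons => -[um] lu.
by rewrite -um sum_step_weight_diag_coef ?mulr0 // um.
Qed.

(** Induction on the number of entries: the last run of the word is either
    empty or begins with the only generator that involves the last entry. *)
Lemma word_trace_normal m k s : normal_word m s -> (m <= n)%N ->
  (forall i, k i < d)%N ->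
  word_trace m k s
  = ((s == [::]) && all (fun i => k i == 0%N) (iota 0 m))%:R.
Proof.
move=> ns mn kd; elim: ns mn => {m s} [|m s l ns IH lm] mn.
  by rewrite /word_trace big_seq1 /t_weight big_nil /path_weight !mulr1.
have sm := normal_word_bound ns.
case: l lm => [|l] lm.
  rewrite cats0 word_trace_restrict // IH; last exact: ltnW.
  rewrite -[m.+1 in RHS]addn1 iotaD all_cat /= andbT add0n andbA.
  by case: (k m == _); rewrite ?andbT ?andbF.
case: m => [//|m] in mn lm ns sm IH *.
rewrite downS // word_trace_crossing //; last first.
  by apply/allP => i; rewrite mem_down //=; lia.
by case: s {IH ns sm}.
Qed.

End SeminormalCoefficients.

(** * Standard tableaux *)

Section OrdinalWords.

Variables (n : nat) (T : eqType).
Implicit Types (f : 'I_n -> T) (a : T) (m : nat).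

Lemma take_enum_ord m : take m (enum 'I_n) =
  [seq j : 'I_n <- enum 'I_n | (j < m)%N].
Proof.
apply: (inj_map val_inj); rewrite map_take -(filter_map _ (fun j => j < m)%N).
rewrite val_enum_ord; have [mn|/ltnW nm] := leqP m n.
  by rewrite (filter_iota_ltn 0 mn) take_iota (minn_idPl mn).
rewrite take_oversize ?size_iota //; apply/esym/all_filterP/allP => j.
by rewrite mem_iota => /andP[_ jn]; apply: leq_trans nm.
Qed.

Lemma nth_codom_ord a f (i : 'I_n) : nth a (codom f) i = f i.
Proof. by rewrite (nth_map i) ?size_enum_ord // nth_ord_enum. Qed.

Lemma count_take_codom f a m :
  count_mem a (take m (codom f)) = #|[set j : 'I_n | (j < m)%N && (f j == a)]|.
Proof.
rewrite -map_take count_map take_enum_ord count_filter cardsE cardE.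
rewrite [X in _ = size X]/enum_mem -enumT size_filter.
by apply: eq_count => j /=; rewrite unfold_in /= andbC.
Qed.

Lemma card_ord_lt m : (m <= n)%N -> #|[set c : 'I_n | (c < m)%N]| = m.
Proof.
move=> mn; rewrite cardsE -sum1_card.
transitivity (\sum_(c < n | (c < m)%N) 1)%N; first by apply: eq_bigl.
by rewrite -(big_ord_widen n (fun=> 1%N) mn) sum1_card card_ord.
Qed.

End OrdinalWords.

Section Tableaux.

Variables (d n : nat).
Local Notation letter := ('I_d * 'I_n)%type.
Implicit Types (lam mu : dpart d n) (T : {ffun 'I_n -> dnode d n}).

Lemma size_part lam k : size (part lam k) = n.
Proof. by rewrite size_map size_tuple. Qed.

Lemma sorted_part lam k : sorted geq (part lam k).
Proof. by case: lam => l lP; have /andP[/forallP/(_ k)] := lP. Qed.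

Lemma part_le lam k r : (nth 0%N (part lam k) r <= n)%N.
Proof.
have [rn|nr] := ltnP r n; last by rewrite nth_default ?size_part.
by rewrite (nth_map ord0) ?size_tuple // -ltnS ltn_ord.
Qed.

Lemma part_inj lam mu : (forall k, part lam k = part mu k) -> lam = mu.
Proof.
move=> E; apply/val_inj/ffunP => k; apply/val_inj.
exact: (inj_map val_inj) (E k).
Qed.

Lemma sum_part lam : (\sum_(k < d) \sum_(r < n) nth 0 (part lam k) r = n)%N.
Proof.
case: lam => l lP; have /andP[_ /eqP E] := lP; apply: etrans E.
apply: eq_bigr => k _.
by rewrite sumnE (big_nth 0%N) size_map size_tuple big_mkord.
Qed.

(** A product over the boxes is computed component by component, then row by
    row. *)
Lemma big_nodes (V : Type) (idx : V) (op : Monoid.com_law idx) lam F :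
  \big[op/idx]_(th in nodes lam) F th
  = \big[op/idx]_(k < d) \big[op/idx]_(r < n)
      \big[op/idx]_(c : 'I_n | (c < nth 0%N (part lam k) r)%N) F (r, c, k).
Proof.
transitivity (\big[op/idx]_(th :
  dnode d n | (th.1.2 < nth 0%N (part lam th.2) th.1.1)%N) F (th.1, th.2)).
  by apply: eq_big => [th|[? ?] _]; rewrite ?inE.
rewrite -(pair_big_dep predT
  (fun (rc : 'I_n * 'I_n) k => (rc.2 < nth 0%N (part lam k) rc.1)%N)
  (fun (rc : 'I_n * 'I_n) k => F (rc, k))) /=.
rewrite (exchange_big_dep predT) //=; apply: eq_bigr => k _.
rewrite pair_big_dep /=.
by apply: eq_big => [[? ?]|[? ?] _].
Qed.

Lemma card_nodes lam : #|nodes lam| = n.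
Proof.
rewrite -sum1_card big_nodes -[RHS](sum_part lam).
apply: eq_bigr => k _; apply: eq_bigr => r _.
by rewrite sum1dep_card card_ord_lt ?part_le.
Qed.

Definition letter_at T (i : 'I_n) : letter := (node_pos (T i), node_row (T i)).

Definition tab_word T : seq letter := codom (letter_at T).

Lemma size_tab_word T : size (tab_word T) = n.
Proof. by rewrite size_codom card_ord. Qed.

Definition is_stdtab lam T := is_tableau lam T && is_standard T.

Section OneTableau.
Variables (lam : dpart d n) (T : {ffun 'I_n -> dnode d n}).
Hypothesis stdT : is_stdtab lam T.

Lemma stdtab_inj : injective T.
Proof. by case/andP: stdT => /andP[/injectiveP]. Qed.

Lemma stdtab_node i : T i \in nodes lam.
Proof. by case/andP: stdT => /andP[_ /eqP <-] _; rewrite imset_f. Qed.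

Lemma stdtab_surj th : th \in nodes lam -> exists i, T i = th.
Proof. by case/andP: stdT => /andP[_ /eqP <-] _ /imsetP[i _ ->]; exists i. Qed.

Lemma stdtab_lt i j : node_pos (T i) = node_pos (T j) ->
  (node_row (T i) = node_row (T j) /\ (node_col (T i) < node_col (T j))%N)
  \/ (node_col (T i) = node_col (T j) /\ (node_row (T i) < node_row (T j))%N) ->
  (i < j)%N.
Proof.
move=> /eqP ij H; case/andP: stdT => _ /forallP/(_ i)/forallP/(_ j).
rewrite ij /= => /implyP; apply.
by case: H => -[-> ->]; rewrite eqxx ?orbT.
Qed.

Lemma stdtab_eq i j : letter_at T i = letter_at T j ->
  node_col (T i) = node_col (T j) -> i = j.
Proof.
rewrite /letter_at /node_pos /node_row /node_col => -[ek er] ec;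
  apply: stdtab_inj.
by case: (T i) (T j) ek er ec => [[? ?] ?] [[? ?] ?] /= -> -> ->.
Qed.

Lemma stdtab_row_lt i j : letter_at T i = letter_at T j ->
  (j < i)%N = (node_col (T j) < node_col (T i))%N.
Proof.
move=> eij; case: (ltngtP (node_col (T j)) (node_col (T i))) => [h|h|h].
- by apply: stdtab_lt; case: eij; [|left].
- apply/negbTE; rewrite -leqNgt; apply: ltnW.
  by apply: stdtab_lt; case: eij; [|left].
- by have -> := stdtab_eq eij (esym (val_inj h)); rewrite ltnn.
Qed.

(** The entries of a row of a tableau are told apart by their columns, so
    they can be counted by columns. *)
Lemma card_row_entries m a :
  #|[set j : 'I_n | (j < m)%N && (letter_at T j == a)]|
  = #|[set node_col (T j) | j : 'I_n & (j < m)%N && (letter_at T j == a)]|.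
Proof.
rewrite card_in_imset; first by rewrite cardsE.
move=> i j; rewrite !inE => /andP[_ /eqP ia] /andP[_ /eqP ja].
by apply: stdtab_eq; rewrite ia.
Qed.

End OneTableau.

End Tableaux.

(** * Standard tableaux as lattice words *)

Section TableauWords.

Variables (d n : nat).
Local Notation letter := ('I_d * 'I_n)%type.
Implicit Types (lam mu : dpart d n) (T : {ffun 'I_n -> dnode d n}).
Implicit Types (w : seq letter) (a b : letter).

Section StandardToLattice.
Variables (lam : dpart d n) (T : {ffun 'I_n -> dnode d n}).
Hypothesis stdT : is_stdtab lam T.

Lemma node_of_letter (c : 'I_n) a : (c < nth 0%N (part lam a.1) a.2)%N ->
  exists i, letter_at T i = a /\ node_col (T i) = c.
Proof.
case: a => k r /= cr; have : ((r, c), k) \in nodes lam by rewrite inE.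
by move=> /(stdtab_surj stdT)[i Ti]; exists i; rewrite /letter_at Ti.
Qed.

Lemma stdtab_col_lt i :
  (node_col (T i) < nth 0%N (part lam (node_pos (T i))) (node_row (T i)))%N.
Proof. by have := stdtab_node stdT i; rewrite inE. Qed.

(** The entries to the left of entry i are the smaller entries of its row. *)
Lemma stdtab_col i :
  node_col (T i) = count_mem (letter_at T i) (take i (tab_word T)) :> nat.
Proof.
rewrite count_take_codom (card_row_entries stdT).
rewrite -[LHS](@card_ord_lt n); last exact/ltnW.
apply: eq_card => c; rewrite inE; apply/idP/imsetP => [ci|[j]].
  have [j [ej ec]] : exists j, letter_at T j = letter_at T i /\ node_col (T j)
    = c.
    by apply: node_of_letter; apply: ltn_trans ci (stdtab_col_lt i).
  by exists j => //; rewrite inE (stdtab_row_lt stdT) // -?ej ?ec ?ci ?eqxx.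
rewrite inE => /andP[ji /eqP ej] {c}->.
by rewrite -(stdtab_row_lt stdT).
Qed.

Lemma count_tab_word k (r : 'I_n) :
  count_mem (k, r) (tab_word T) = nth 0%N (part lam k) r.
Proof.
rewrite -[tab_word T](take_oversize (n := n)) ?size_tab_word //.
rewrite count_take_codom (card_row_entries stdT).
rewrite -[RHS](@card_ord_lt n) ?part_le //.
apply: eq_card => c; rewrite inE; apply/imsetP/idP => [[j]|cr].
  rewrite inE => /andP[_ /eqP[<- <-]] {c}->; exact: stdtab_col_lt.
have [j [ej ec]] := @node_of_letter c (k, r) cr.
by exists j; rewrite // inE ltn_ord ej eqxx.
Qed.

Lemma row_counts_tab_word k : row_counts k (tab_word T) = part lam k.
Proof.
apply: (@eq_from_nth _ 0%N) => [|r];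
  rewrite size_row_counts ?size_part // => rn.
by rewrite (_ : r = Ordinal rn) // nth_row_counts count_tab_word.
Qed.

(** Above each box of a lower row there is a box of the upper row, which
    holds a smaller entry, so the upper row always has at least as many
    entries. *)
Lemma lattice_tab_word : lattice (tab_word T).
Proof.
apply/allP => m _; apply/dominantP => k r1 r2 r12.
rewrite !count_take_codom !(card_row_entries stdT).
apply/subset_leq_card/subsetP => c /imsetP[j];
  rewrite inE => /andP[jm /eqP[jk jr]] {c}->.
have [i [ei ec]] : exists i, letter_at T i = (k, r1) /\ node_col (T i) =
  node_col (T j).
  apply: node_of_letter => /=; have := stdtab_col_lt j; rewrite jk jr => cj.
  by apply: leq_trans cj _; apply: nth_sorted_geq (sorted_part lam k) r12.
apply/imsetP; exists i; rewrite ?ec // inE ei eqxx andbT.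
case: ei => ik ir; move: r12; rewrite leq_eqVlt => /orP[/eqP r12|r12].
  have -> // : i = j.
  by apply: (stdtab_eq stdT) => //;
    rewrite /letter_at ik ir jk jr (val_inj r12).
apply: ltn_trans jm; apply: (stdtab_lt stdT); rewrite ?ik ?jk //.
by right; rewrite ec ir jr.
Qed.

End StandardToLattice.

(** The word determines the columns, by counting, and hence also the shape. *)
Lemma tab_word_inj lam mu T U : is_stdtab lam T -> is_stdtab mu U ->
  tab_word T = tab_word U -> lam = mu /\ T = U.
Proof.
move=> sT sU E; split.
  by apply: part_inj => k; rewrite -(row_counts_tab_word sT) E
    (row_counts_tab_word sU).
have Ei i : letter_at T i = letter_at U i.
  have := congr1 (nth (letter_at T i) ^~ i) E.
  by rewrite !nth_codom_ord.
apply/ffunP => i; have := stdtab_col sT i; have := stdtab_col sU i.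
rewrite -E -Ei => <- /val_inj; have := Ei i; rewrite /letter_at.
rewrite /node_pos /node_row /node_col.
by case: (T i) (U i) => [[? ?] ?] [[? ?] ?] /= [-> ->] ->.
Qed.

Section LatticeToStandard.
Variable f : 'I_n -> letter.
Hypothesis latf : lattice (codom f).
Local Notation cnt a m := (count_mem a (take m (codom f))).

Lemma count_take_lt (i : 'I_n) a : (cnt a i < n)%N.
Proof.
apply: leq_ltn_trans (count_size _ _) _;
  rewrite size_takel ?size_codom ?card_ord //.
exact: ltnW.
Qed.

(** Entry i is put at the end of the row given by letter i. *)
Definition word_tab : {ffun 'I_n -> dnode d n} :=
  [ffun i => ((f i).2, Ordinal (count_take_lt i (f i)), (f i).1)].

Lemma letter_at_word_tab i : letter_at word_tab i = f i.
Proof. by rewrite /letter_at ffunE -surjective_pairing. Qed.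

Lemma tab_word_word_tab : tab_word word_tab = codom f.
Proof. by apply: eq_codom => i; rewrite letter_at_word_tab. Qed.

Lemma leq_cnt a m p : (m <= p)%N -> (cnt a m <= cnt a p)%N.
Proof. by move=> mp; rewrite -(take_takel _ mp) leq_count_subseq ?take_subseq.
Qed.

Lemma cntS i : cnt (f i) i.+1 = (cnt (f i) i).+1.
Proof.
rewrite (take_nth (f i)) ?size_codom ?card_ord // -cats1 count_cat /=.
by rewrite nth_codom_ord eqxx addn1.
Qed.

Lemma cnt_dominant k (r1 r2 : 'I_n) m : (r1 <= r2)%N ->
  (cnt (k, r2) m <= cnt (k, r1) m)%N.
Proof.
by move=> r12; have /dominantP := lattice_dominant (lattice_take m latf); apply.
Qed.

Definition word_part_val : {ffun 'I_d -> n.-tuple 'I_n.+1} :=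
  [ffun k => [tuple inord (count_mem (k, r) (codom f)) | r < n]].

Lemma map_word_part_val k : map val (word_part_val k) = row_counts k (codom f).
Proof.
rewrite ffunE /= -map_comp; apply: eq_map => r /=.
rewrite inordK // ltnS.
by rewrite (leq_trans (count_size _ _)) // size_codom card_ord.
Qed.

Lemma word_part_subproof : is_dpart word_part_val.
Proof.
apply/andP; split; first apply/forallP => k; last apply/eqP.
  by rewrite map_word_part_val sorted_row_counts ?lattice_dominant.
transitivity (size (codom f)); last by rewrite size_codom card_ord.
rewrite -sum_count_letters.
rewrite (eq_bigr (fun a : letter => count_mem (a.1, a.2) (codom f)));
  last by case.
rewrite -(pair_bigA _ (fun k r => count_mem (k, r) (codom f))) /=.
apply: eq_bigr => k _; rewrite map_word_part_val sumnE big_map.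
by rewrite big_enum.
Qed.

Definition word_part : dpart d n := DPart word_part_subproof.

Lemma part_word_part k : part word_part k = row_counts k (codom f).
Proof. exact: map_word_part_val. Qed.

(** If the box of j is below the box of i in the same column c, then just
    after j has been placed the lower row has c + 1 entries, so by dominance
    the upper row has already got its entry in column c. *)
Lemma word_tab_std : is_stdtab word_part word_tab.
Proof.
have injT : injective word_tab.
  move=> i j Tij; have fij :
    f i = f j by rewrite -!letter_at_word_tab /letter_at Tij.
  have cij : cnt (f i) i = cnt (f i) j.
    by move/(congr1 (@node_col d n)): Tij; rewrite !ffunE => /(congr1 val) /=;
      rewrite fij.
  apply/val_inj; case: (ltngtP i j) => //= ij.
    by have := leq_cnt (f i) ij; rewrite cntS cij ltnn.
  by have := leq_cnt (f i) ij; rewrite fij cntS -fij cij ltnn.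
apply/andP; split.
  apply/andP; split; first exact/injectiveP.
  rewrite eqEcard card_imset // cardsT card_ord card_nodes leqnn andbT.
  apply/subsetP => _ /imsetP[i _ ->];
    rewrite inE ffunE /node_col /node_pos /node_row /=.
  rewrite part_word_part nth_row_counts -surjective_pairing.
  have := leq_cnt (f i) (ltn_ord i); rewrite cntS => /leq_trans; apply.
  by rewrite take_oversize // size_codom card_ord.
apply/forallP => i; apply/forallP => j; apply/implyP => /eqP ijk; apply/implyP.
have Ek := ijk; rewrite !ffunE /node_pos /= in Ek.
rewrite !ffunE /node_row /node_col -!val_eqE /= => /orP[]/andP[/eqP].
  move=> /val_inj Er; have Ef : f i = f j.
    by rewrite [f i]surjective_pairing Ek Er -surjective_pairing.
  rewrite Ef; apply: contraTT; rewrite -!leqNgt; exact: leq_cnt.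
move=> Ec Er; have ij : i != j by apply: contraTneq Er => ->; rewrite ltnn.
rewrite ltn_neqAle ij leqNgt; apply/negP => ji.
have := leq_cnt (f i) ji; rewrite Ec leqNgt => /negP; apply.
rewrite -cntS [f j]surjective_pairing [X in cnt X _]surjective_pairing -Ek.
exact/cnt_dominant/ltnW.
Qed.

End LatticeToStandard.

Lemma standard_of_lattice w : lattice w -> size w = n ->
  exists lam T, is_stdtab lam T /\ tab_word T = w.
Proof.
move=> lw sw; pose t : n.-tuple letter := Tuple (introT eqP sw).
have wE : w = codom (tnth t) by rewrite codomE map_tnth_enum.
rewrite wE in lw *; exists (word_part lw), (word_tab (tnth t)).
by split; [exact: word_tab_std | exact: tab_word_word_tab].
Qed.

End TableauWords.

(** * Exchanging two consecutive entries *)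

Section Swapping.

Variables (d n : nat).
Local Notation letter := ('I_d * 'I_n)%type.
Implicit Types (w : seq letter).

Lemma nth_swap x0 i j w : (i.+1 < size w)%N ->
  nth x0 (swap i w) j
  = nth x0 w (if j == i then i.+1 else if j == i.+1 then i else j).
Proof.
move=> /split_word[u [a [b [v [-> <-]]]]]; rewrite swap_cat !nth_cat.
have [->|ji] := eqVneq j (size u).
  by rewrite ltnn subnn /= ltnNge leqnSn subSnn.
have [->|ji1] := eqVneq j (size u).+1.
  by rewrite ltnNge leqnSn /= subSnn ltnn subnn.
case: ltnP => // uj.
by have -> : (j - size u = (j - size u).-2.+2)%N by lia.
Qed.

Variables (lam : dpart d n) (T : {ffun 'I_n -> dnode d n}) (i : 'I_n.-1).
Hypothesis stdT : is_stdtab lam T.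

Lemma tab_actE (T' : {ffun 'I_n -> dnode d n}) (j : 'I_n) :
  tab_act T' (simple_transp i) j = T' (simple_transp i j).
Proof. by rewrite ffunE tpermV. Qed.

Lemma tab_actK : tab_act (tab_act T (simple_transp i)) (simple_transp i) = T.
Proof. by apply/ffunP => j; rewrite !tab_actE tpermK. Qed.

Lemma simple_transpE (j : 'I_n) :
  simple_transp i j
  = (if j == i :> nat then i.+1
     else if j == i.+1 :> nat then nat_of_ord i else nat_of_ord j) :> nat.
Proof.
rewrite /simple_transp; case: tpermP => [->|->|/eqP + /eqP].
- by rewrite eqxx.
- by rewrite /= eqn_leq ltnn eqxx.
- by rewrite -!val_eqE /= => /negPf -> /negPf ->.
Qed.

Lemma ltn_gen_word : (i.+1 < n)%N.
Proof. exact: shi_subproof. Qed.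

Lemma tab_word_act :
  tab_word (tab_act T (simple_transp i)) = swap i (tab_word T).
Proof.
have i1 : (i.+1 < size (tab_word T))%N by rewrite size_tab_word ltn_gen_word.
apply: (@eq_from_nth _ (letter_at T (slo i))) => [|j].
  by rewrite size_swap !size_tab_word.
rewrite size_tab_word => jn; rewrite nth_swap //.
rewrite (nth_codom_ord _ _ (Ordinal jn)) /letter_at !tab_actE.
by have /= <- := simple_transpE (Ordinal jn); rewrite nth_codom_ord.
Qed.

Lemma split_tab_word :
  take i.+1 (tab_word T) = rcons (take i (tab_word T)) (letter_at T (slo i))
  /\ tab_word T = take i (tab_word T)
       ++ letter_at T (slo i) :: letter_at T (shi i) :: drop i.+2 (tab_word T).
Proof.
have h (j : 'I_n) : drop j (tab_word T) = letter_at T j :: drop j.+1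
  (tab_word T).
  by rewrite (drop_nth (letter_at T j)) ?size_tab_word // nth_codom_ord.
split.
  by rewrite (take_nth (letter_at T (slo i))) ?nth_codom_ord
    ?(nth_codom_ord _ _ (slo i)) // size_tab_word ltnW ?ltn_gen_word.
by rewrite -{1}[tab_word T](cat_take_drop i) (h (slo i)) (h (shi i)).
Qed.

(** The exchange reverses the order of the two entries i and i + 1 and of no
    other pair. *)
Lemma act_standard :
  ~~ [&& node_pos (T (slo i)) == node_pos (T (shi i))
       & ((node_row (T (slo i)) == node_row (T (shi i)))
         && (node_col (T (slo i)) < node_col (T (shi i))))
         || ((node_col (T (slo i)) == node_col (T (shi i)))
         && (node_row (T (slo i)) < node_row (T (shi i))))]%N ->
  is_stdtab lam (tab_act T (simple_transp i)).
Proof.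
move=> nrel; case/andP: (stdT) => /andP[/injectiveP injT /eqP imT].
move=> /forallP sT; apply/andP; split.
  apply/andP; split.
    by apply/injectiveP => j k; rewrite !tab_actE => /injT/perm_inj.
  rewrite -imT; apply/eqP/setP => th; apply/imsetP/imsetP => -[j _ ->].
    by exists (simple_transp i j); rewrite ?tab_actE.
  by exists (simple_transp i j); rewrite ?tab_actE ?tpermK.
apply/forallP => j; apply/forallP => k; rewrite !tab_actE.
apply/implyP => pjk; apply/implyP => rjk.
have := sT (simple_transp i j) => /forallP/(_ (simple_transp i k)).
rewrite pjk rjk /= !simple_transpE => sjk.
have [ji|ji] := eqVneq (j : nat) i.+1; last by move: sjk; do ![case: eqP]; lia.
have [ki|ki] := eqVneq (k : nat) i; last by move: sjk; do ![case: eqP]; lia.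
case/negP: nrel.
have sj : simple_transp i j = slo i by apply/ord_inj;
  rewrite simple_transpE /= ji eqn_leq ltnn eqxx.
have sk : simple_transp i k = shi i by apply/ord_inj;
  rewrite simple_transpE /= ki eqxx.
by rewrite -sj -sk pjk.
Qed.

(** The exchange of i and i + 1 can only fail to be standard if their boxes
    are adjacent. In the same row, the two letters are equal; in the same
    column, the exchanged word has a prefix in which the lower row is longer
    than the upper one. *)
Lemma swappable_stdtab :
  swappable i (tab_word T) = is_stdtab lam (tab_act T (simple_transp i)).
Proof.
apply/idP/idP => [/andP[neqw lw]|sT']; last first.
  rewrite /swappable -tab_word_act (lattice_tab_word sT') andbT.
  apply/eqP => /(tab_word_inj sT' stdT)[_ /ffunP/(_ (slo i))].
  rewrite tab_actE => /(stdtab_inj stdT)/(congr1 val).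
  by rewrite /= simple_transpE /= eqxx => /eqP; rewrite eqn_leq ltnn.
apply: act_standard; apply/negP => /andP[/eqP pos].
have [t1 wE] := split_tab_word.
set u := take i _ in wE t1; set a := letter_at T (slo i) in wE t1.
set b := letter_at T (shi i) in wE.
have su : size u = i by rewrite size_takel // size_tab_word;
  have := ltn_gen_word; lia.
have swE (c e : letter) v : swap i (u ++ c :: e :: v) = u ++ e :: c :: v.
  by have := swap_cat u c e v; rewrite su.
move: lw neqw; rewrite wE swE => lw neqw.
have ab : a != b by apply: contraNneq neqw => ->; exact: eqxx.
case/orP => /andP[/eqP h1 h2].
  by case/eqP: ab; rewrite /a /b /letter_at pos h1.
have := stdtab_col stdT (slo i); rewrite -/u -/a /= => colA.
have := stdtab_col stdT (shi i);
  rewrite /= t1 -/b -cats1 count_cat /= (negPf ab) !addn0 => colB.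
have := lattice_dominant (lattice_take (size u).+1 lw).
rewrite take_cat ltnNge leqnSn /= subSnn => /dominantP/(_ a.1 a.2 b.2).
rewrite [X in (X, b.2)](_ : _ = b.1) // -!surjective_pairing !count_cat /= eqxx.
rewrite [b == a]eq_sym (negPf ab) !addn0 -colA -colB h1 addn1 ltnn.
by move=> /(_ (ltnW h2)).
Qed.

End Swapping.

(** * Matrices of the seminormal representations *)

Section Seminormal.

Variables (K : fieldType) (q : K) (d n : nat).
Hypothesis q_neq0 : q != 0.
Variables (xi : 'I_d -> K) (lam : dpart d n).
Variable rho : YH q d n -> 'M[K]_#|{: stdtab lam}|.
Hypothesis rhoP : seminormal_rep xi rho.
Local Notation letter := ('I_d * 'I_n)%type.
Implicit Types (S T U : stdtab lam).

Lemma stdtabP T : is_stdtab lam T.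
Proof. by case: T. Qed.

Lemma rep_mul x y : rho (x * y) = rho x *m rho y.
Proof. by case: rhoP => _ [_ rM] _ _; rewrite rM. Qed.

Lemma rep_one : rho 1 = 1%:M.
Proof. by case: rhoP => _ [r1 _] _ _; rewrite r1. Qed.

Lemma rep_linear : linear rho. Proof. by case: rhoP. Qed.

Lemma rep_add x y : rho (x + y) = rho x + rho y.
Proof. by have := rep_linear 1 x y; rewrite !scale1r. Qed.

Lemma rep0 : rho 0 = 0.
Proof. by have := rep_add 0 0; rewrite addr0 => /esym/eqP;
  rewrite -subr_eq0 addrK => /eqP. Qed.

Lemma rep_scale c x : rho (c *: x) = c *: rho x.
Proof. by have := rep_linear c x 0; rewrite !addr0 rep0 addr0. Qed.

Lemma tab_vecE T : tab_vec K lam T = delta_mx (enum_rank T) 0.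
Proof. by rewrite /tab_vec valK. Qed.

Lemma tab_vec_std (V : {ffun 'I_n -> dnode d n}) : is_stdtab lam V ->
  exists U : stdtab lam, stdtab_val U = V.
Proof. by move=> sV; exists (StdTab sV). Qed.

Lemma tab_vec_nonstd (V : {ffun 'I_n -> dnode d n}) : ~~ is_stdtab lam V ->
  tab_vec K lam V = 0.
Proof. by move=> nsV; rewrite /tab_vec insubF //; apply/negbTE. Qed.

Lemma mul_tab_vec (M : 'M[K]_#|{: stdtab lam}|) S T :
  (M *m tab_vec K lam T) (enum_rank S) 0 = M (enum_rank S) (enum_rank T).
Proof. by rewrite tab_vecE -colE mxE. Qed.

Lemma tab_vec_entry (V : {ffun 'I_n -> dnode d n}) S :
  tab_vec K lam V (enum_rank S) 0 = (V == S :> {ffun _})%:R.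
Proof.
have [sV|nsV] := boolP (is_stdtab lam V); last first.
  rewrite tab_vec_nonstd // mxE; case: eqP => // VS.
  by rewrite VS stdtabP in nsV.
have [U <-] := tab_vec_std sV.
by rewrite tab_vecE mxE andbT (inj_eq enum_rank_inj) eq_sym val_eqE.
Qed.

(** The factor q^(2 (n - 1)) comes from the shift of the beta numbers; it
    cancels in the seminormal coefficients. *)
Lemma letter_param_content T (i : 'I_n) :
  letter_param q (take i (tab_word T)) (letter_at T i)
  = q ^+ (2 * n.-1) * quantum_content q (T i).
Proof.
rewrite letter_paramE -(stdtab_col (stdtabP T)) /box_param /quantum_content /=.
rewrite /letter_at /= !exprnP -expfzDr //; congr (_ ^ _).
have := ltn_ord (node_row (T i)); lia.
Qed.

Lemma rep_g_entry (i : 'I_n.-1) S T :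
  rho (yh_g q d i) (enum_rank S) (enum_rank T)
  = diag_coef q i (tab_word T) * (T == S)%:R
    + off_coef q i (tab_word T)
      * (tab_act T (simple_transp i) == S :> {ffun _})%:R.
Proof.
case: rhoP => _ _ _ /(_ i T) /= H.
rewrite -mul_tab_vec {}H /diag_coef /off_coef.
have [t1 wE] := split_tab_word T i.
have := letter_param_content T (slo i); have := letter_param_content T (shi i).
rewrite /= t1; set u := take i _ in wE *; move=> cb ca.
have -> : drop i (tab_word T)
    = letter_at T (slo i) :: letter_at T (shi i) :: drop i.+2 (tab_word T).
  by rewrite {1}wE drop_size_cat // size_takel // size_tab_word ltnW // ltnW
    // ltn_gen_word.
rewrite [_ == _.1]/= cb ca; case: ifP => _; last first.
  by rewrite mul0r add0r mul1r tab_vec_entry.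
rewrite !mxE !tab_vec_entry val_eqE.
set c' := quantum_content _ (T (shi i)); set c := quantum_content _ (T (slo i)).
have C0 : q ^+ (2 * n.-1) != 0 by rewrite expf_neq0.
move: (q ^+ (2 * n.-1)) C0 => C C0.
have -> : C * c' * (q - q^-1) / (C * c' - C * c) = c' * (q - q^-1) / (c' - c).
  by rewrite -mulrBr -(mulrA C) -mulf_div divff // mul1r.
have -> // : (q * (C * c') - q^-1 * (C * c)) / (C * c' - C * c)
    = (q * c' - q^-1 * c) / (c' - c).
by rewrite -mulrBr !(mulrCA _ C) -mulrBr -mulf_div divff // mul1r.
Qed.

Lemma sum_enum_rank (F : 'I_#|{: stdtab lam}| -> K) :
  \sum_k F k = \sum_U F (enum_rank U).
Proof. by rewrite (reindex enum_rank) //; exact/onW_bij/enum_rank_bij. Qed.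

Lemma rep_g_word_entry (s : seq 'I_n.-1) S T :
  rho (\prod_(i <- s) yh_g q d i) (enum_rank S) (enum_rank T)
  = coef q (map val s) (tab_word S) (tab_word T).
Proof.
elim: s S => [|i s IH] S /=.
  rewrite big_nil rep_one mxE (inj_eq enum_rank_inj);
    congr ((nat_of_bool _)%:R).
  apply/eqP/eqP => [->//|E]; apply/val_inj.
  by have [] := tab_word_inj (stdtabP S) (stdtabP T) E.
rewrite big_cons rep_mul mxE sum_enum_rank.
pose F U := (diag_coef q i (tab_word U) * (U == S)%:R
  + off_coef q i (tab_word U)
    * (tab_act U (simple_transp i) == S :> {ffun _})%:R)
  * coef q (map val s) (tab_word U) (tab_word T).
transitivity (\sum_(U : stdtab lam) F U).
  by apply: eq_bigr => U _; congr (_ * _); [exact: rep_g_entry | exact: IH].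
rewrite /F; under eq_bigr do rewrite mulrDl.
rewrite big_split /= (bigD1 S) //= eqxx mulr1 big1 ?addr0; last first.
  by move=> U /negPf ->; rewrite mulr0 mul0r.
congr (_ + _); rewrite (swappable_stdtab i (stdtabP S)).
have actE U : (tab_act U (simple_transp i) == S :> {ffun _})
    = (stdtab_val U == tab_act S (simple_transp i)).
  by apply/eqP/eqP => [<-|->]; rewrite tab_actK.
case: ifP => [/tab_vec_std[V VE]|nsS].
  rewrite (bigD1 V) //= actE VE eqxx mulr1 big1 ?addr0 => [|U UV].
    by rewrite -tab_word_act -VE.
  rewrite actE -VE; case: eqP => [/val_inj E|_]; last by rewrite mulr0 mul0r.
  by rewrite E eqxx in UV.
apply: big1 => U _; rewrite actE; case: eqP => [E|_];
  last by rewrite mulr0 mul0r.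
by rewrite -E stdtabP in nsS.
Qed.

Definition diag_rep (x : YH q d n) (c : stdtab lam -> K) : Prop :=
  forall T, rho x *m tab_vec K lam T = c T *: tab_vec K lam T.

Lemma diag_rep_entry x c S T : diag_rep x c ->
  rho x (enum_rank S) (enum_rank T) = c T * (T == S)%:R.
Proof. by move=> xc; rewrite -mul_tab_vec xc mxE tab_vec_entry val_eqE. Qed.

Lemma diag_rep1 : diag_rep 1 (fun=> 1).
Proof. by move=> T; rewrite rep_one mul1mx scale1r. Qed.

Lemma diag_repM x y c e : diag_rep x c -> diag_rep y e ->
  diag_rep (x * y) (fun T => c T * e T).
Proof.
move=> xc ye T; rewrite rep_mul -mulmxA ye -scalemxAr xc.
by rewrite scalerA mulrC.
Qed.

Lemma diag_repX x c m : diag_rep x c -> diag_rep (x ^+ m) (fun T => c T ^+ m).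
Proof.
move=> xc; elim: m => [|m IH] T; first by rewrite expr0 diag_rep1.
by rewrite !exprS (diag_repM xc IH).
Qed.

Lemma diag_rep_prod (I : Type) (r : seq I) (P : pred I) (x : I -> YH q d n)
    (c : I -> stdtab lam -> K) :
  (forall i, diag_rep (x i) (c i)) ->
  diag_rep (\prod_(i <- r | P i) x i) (fun T => \prod_(i <- r | P i) c i T).
Proof.
move=> xc; elim: r => [|i r IH] T; first by rewrite !big_nil diag_rep1.
by rewrite !big_cons; case: ifP => _;
  [exact: (diag_repM (xc i) IH) | exact: IH].
Qed.

Lemma diag_repD x y c e : diag_rep x c -> diag_rep y e ->
  diag_rep (x + y) (fun T => c T + e T).
Proof. by move=> xc ye T; rewrite rep_add mulmxDl xc ye -scalerDl. Qed.

Lemma diag_repZ a x c : diag_rep x c -> diag_rep (a *: x) (fun T => a * c T).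
Proof. by move=> xc T; rewrite rep_scale -scalemxAl xc scalerA. Qed.

Lemma diag_rep_t j : diag_rep (yh_t q d j) (fun T => xi (node_pos (T j))).
Proof. by case: rhoP => _ _ rt _ T; exact: rt. Qed.

Lemma trace_diag_rep x c : diag_rep x c -> \tr (rho x) = \sum_T c T.
Proof.
move=> xc; rewrite /mxtrace sum_enum_rank; apply: eq_bigr => T _.
by rewrite (diag_rep_entry _ _ xc) eqxx mulr1.
Qed.

(** The t_j are diagonal, so only the diagonal coefficients of the product
    of the g_i matter. *)
Lemma trace_monomial (k : 'I_n -> 'I_d) (s : seq 'I_n.-1) :
  \tr (rho (yh_monomial q k s))
  = \sum_(T : stdtab lam) (\prod_(j < n) xi (node_pos (T j)) ^+ k j)
      * coef q (map val s) (tab_word T) (tab_word T).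
Proof.
rewrite /mxtrace sum_enum_rank; apply: eq_bigr => T _.
have D : diag_rep (\prod_(j < n) yh_t q d j ^+ k j)
    (fun T => \prod_(j < n) xi (node_pos (T j)) ^+ k j).
  by apply: diag_rep_prod => j; apply/diag_repX/diag_rep_t.
rewrite rep_mul mxE sum_enum_rank (bigD1 T) //= (diag_rep_entry _ _ D).
rewrite eqxx mulr1 rep_g_word_entry [X in _ + X]big1 ?addr0 // => U UT.
by rewrite (diag_rep_entry _ _ D) (negPf UT) mulr0 mul0r.
Qed.

End Seminormal.

(** * Jucys--Murphy elements and independence of the characters *)

Section JucysMurphyStep.

Variables (K : fieldType) (q : K) (d n : nat).
Hypotheses (q_neq0 : q != 0) (q_gen : forall m, (0 < m)%N -> q ^+ m != 1).
Hypothesis d_neq0 : d%:R != 0 :> K.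
Variable xi : 'I_d -> K.
Hypothesis xi_root : forall k, xi k ^+ d = 1.
Variable lam : dpart d n.
Variable rho : YH q d n -> 'M[K]_#|{: stdtab lam}|.
Hypothesis rhoP : seminormal_rep xi rho.
Implicit Types (S T U : stdtab lam).
Local Notation v_ V := (tab_vec K lam V).

(** All summands of e_i act as xi^d = 1. *)
Lemma rep_e (i : 'I_n.-1) T :
  node_pos (T (slo i)) = node_pos (T (shi i)) ->
  rho (yh_e q d i) *m v_ T = v_ T.
Proof.
move=> pos; rewrite /yh_e (rep_scale rhoP) -scalemxAl.
have D (r : seq 'I_d) :
    rho (\sum_(s <- r) yh_t q d (slo i) ^+ s * yh_t q d (shi i) ^+ (d - s))
      *m v_ T = (\sum_(s <- r) 1) *: v_ T.
  elim: r => [|s r IH]; first by rewrite !big_nil (rep0 rhoP) mul0mx scale0r.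
  rewrite !big_cons (rep_add rhoP) mulmxDl IH.
  rewrite (diag_repM rhoP (diag_repX rhoP s (diag_rep_t rhoP (slo i)))
    (diag_repX rhoP (d - s) (diag_rep_t rhoP (shi i)))) /= pos -exprD subnKC;
      last exact/ltnW.
  by rewrite xi_root -scalerDl.
by rewrite D sumr_const card_ord scalerA mulVf ?scale1r.
Qed.

Lemma content_neq T (i : 'I_n.-1) :
  node_pos (T (slo i)) = node_pos (T (shi i)) ->
  quantum_content q (T (shi i)) != quantum_content q (T (slo i)).
Proof.
move=> pos; have C0 : q ^+ (2 * n.-1) != 0 by rewrite expf_neq0.
rewrite -(inj_eq (mulfI C0)) -!(letter_param_content q_neq0).
have [t1 _] := split_tab_word T i; rewrite [take (shi i) _]t1.
have := lattice_dominant (lattice_take i (lattice_tab_word (stdtabP T))).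
set u := take i _; set a := letter_at T (slo i);
  set b := letter_at T (shi i) => du.
have [ab|ab] := eqVneq b a.
  rewrite ab !letter_paramE -cats1 count_cat /= eqxx addn0 addn1 /box_param
    addSn mulnS.
  rewrite exprD -[X in _ != X]mul1r (inj_eq (mulIf _)) ?expf_neq0 //.
  exact: q_gen.
have -> : letter_param q (rcons u a) b = letter_param q u b.
  by rewrite !letter_paramE -cats1 count_cat /= eq_sym (negPf ab) !addn0.
apply: contraNneq ab => E;
  have {}E : letter_param q u (a.1, b.2) = letter_param q u (a.1, a.2).
  by rewrite [a.1 in LHS](_ : _ = b.1) // -!surjective_pairing.
have := letter_param_inj q_neq0 q_gen (k := a.1) du E => b2.
by rewrite /a /b in b2 *; rewrite /letter_at /= in b2 *; rewrite pos b2.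
Qed.

(** Let c and c' be the contents of i and i + 1 in T. If both entries are in
    the same position, g v_T is the sum of a v_T with a (c' - c) = c' (q -
    q^-1), and of an eigenvector of X for c'. Hence X g v_T = c' g v_T - c'
    (q - q^-1) v_T, and applying g gives c' v_T by the quadratic relation.
    This does not depend on whether the exchanged tableau is standard. *)
Lemma diag_rep_content_step (i : 'I_n.-1) X :
  diag_rep rho X (fun T => quantum_content q (T (slo i))) ->
  diag_rep rho (yh_g q d i * X * yh_g q d i)
    (fun T => quantum_content q (T (shi i))).
Proof.
move=> DX T; rewrite !(rep_mul rhoP) -!mulmxA.
case: (rhoP) => _ _ _ /(_ i) /= gE.
set Ts := tab_act T (simple_transp i).
set c := quantum_content q (T (slo i)); set c' := quantum_content q (T (shi i)).
have TsE : (Ts (slo i) = T (shi i)) * (Ts (shi i) = T (slo i)).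
  by rewrite /Ts !tab_actE /simple_transp tpermL tpermR.
have XTs : rho X *m v_ Ts = c' *: v_ Ts.
  have [/tab_vec_std[U UE]|/tab_vec_nonstd ->] := boolP (is_stdtab lam Ts).
    by rewrite -UE DX UE TsE.
  by rewrite mulmx0 scaler0.
have [pos|npos] := eqVneq (node_pos (T (slo i))) (node_pos (T (shi i)));
  last first.
  have [U UE] : exists U : stdtab lam, stdtab_val U = Ts.
    by apply: tab_vec_std; apply: (act_standard (stdtabP T));
      rewrite (negPf npos).
  rewrite gE (negPf npos) XTs -scalemxAr -/Ts -UE gE UE !TsE eq_sym
    (negPf npos).
  by rewrite tab_actK.
have cc : c' - c != 0 by rewrite subr_eq0 content_neq.
(* The off-diagonal part y is 0 when the exchanged tableau is not standard. *)
pose a := c' * (q - q^-1) / (c' - c);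
  pose y := ((q * c' - q^-1 * c) / (c' - c)) *: v_ Ts.
have gT : rho (yh_g q d i) *m v_ T = a *: v_ T + y.
  by rewrite gE pos eqxx.
have Xy : rho X *m y = c' *: y by rewrite /y -scalemxAr XTs !scalerA mulrC.
have ey : rho (yh_e q d i) *m y = y.
  rewrite /y -scalemxAr; congr (_ *: _).
  have [/tab_vec_std[U UE]|/tab_vec_nonstd ->] := boolP (is_stdtab lam Ts).
    by rewrite -UE rep_e // UE !TsE.
  by rewrite mulmx0.
have ggT : rho (yh_g q d i) *m (rho (yh_g q d i) *m v_ T)
    = v_ T + (q - q^-1) *: (rho (yh_g q d i) *m v_ T).
  rewrite mulmxA -(rep_mul rhoP) -expr2 yh_gquad (rep_add rhoP) (rep_one rhoP).
  rewrite (rep_scale rhoP) (rep_mul rhoP) mulmxDl mul1mx -scalemxAl -mulmxA.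
  congr (_ + _ *: _); rewrite gT mulmxDr ey -scalemxAr rep_e //.
have XgT : rho X *m (rho (yh_g q d i) *m v_ T)
    = c' *: (rho (yh_g q d i) *m v_ T) - (c' * (q - q^-1)) *: v_ T.
  rewrite gT mulmxDr Xy -scalemxAr DX -/c scalerDr !scalerA.
  rewrite addrAC -scalerBl; congr (_ *: _ + _).
  by rewrite /a; field; rewrite q_neq0 cc.
rewrite XgT mulmxBr -!scalemxAr ggT scalerDr scalerA.
by rewrite addrK.
Qed.

End JucysMurphyStep.

Section Separation.

Variables (K : fieldType) (q : K) (d n : nat).
Hypotheses (q_neq0 : q != 0) (q_gen : forall m, (0 < m)%N -> q ^+ m != 1).

Fixpoint jucys_murphy (i : nat) : YH q d n :=
  if i is i'.+1 then
    if insub i' is Some j then yh_g q d j * jucys_murphy i' * yh_g q d j else 0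
  else 1.

(** Once the shape of the smaller entries is known, the position and the
    content of the next entry determine its row, because the addable boxes
    of a partition have different contents. *)
Lemma stdtab_sep (lam mu : dpart d n) (T U : {ffun 'I_n -> dnode d n}) :
  is_stdtab lam T -> is_stdtab mu U ->
  (forall i, node_pos (T i) = node_pos (U i)) ->
  (forall i, quantum_content q (T i) = quantum_content q (U i)) ->
  lam = mu /\ T = U.
Proof.
move=> sT sU pos cont; apply: tab_word_inj => //.
suff H m : (m <= n)%N -> take m (tab_word T) = take m (tab_word U).
  by have := H n (leqnn n); rewrite !take_oversize ?size_tab_word.
elim: m => [|m IH] mn; first by rewrite !take0.
pose i := Ordinal mn; have {}IH := IH (ltnW mn).
have nthE V : take m.+1 (tab_word V) = rcons (take m (tab_word V))
  (letter_at V i).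
  by rewrite (take_nth (letter_at V i)) ?size_tab_word // (nth_codom_ord _ _ i).
rewrite !nthE IH; congr rcons.
have contE (nu : dpart d n) (V : {ffun 'I_n -> dnode d n}) : is_stdtab nu V ->
    letter_param q (take m (tab_word V)) (letter_at V i)
    = q ^+ (2 * n.-1) * quantum_content q (V i).
  by move=> sV; rewrite -(letter_param_content q_neq0 (StdTab sV)).
have := contE _ _ sT; rewrite cont -(contE _ _ sU) IH /letter_at pos.
move=> /(letter_param_inj q_neq0 q_gen (k := node_pos (U i))) -> //.
exact/lattice_dominant/lattice_take/(lattice_tab_word sU).
Qed.

(** The boxes can be numbered by increasing sum of row and column. *)
Lemma exists_stdtab (lam : dpart d n) : exists T, is_stdtab lam T.
Proof.
(* Sum of row and column increases along rows and down columns. *)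
pose key (th : dnode d n) := (node_row th + node_col th)%N.
pose s := sort (relpre key leq) (enum (nodes lam)).
have ss : size s = n by rewrite size_sort -cardE card_nodes.
have us : uniq s by rewrite sort_uniq enum_uniq.
have sorts : sorted (relpre key leq) s by apply: sort_sorted => a b /=;
  exact: leq_total.
pose t := Tuple (introT eqP ss).
have injt : injective (tnth t) by apply/tuple_uniqP.
exists [ffun i => tnth t i]; apply/andP; split.
  apply/andP; split; first by apply/injectiveP => i j; rewrite !ffunE => /injt.
  apply/eqP/setP => th; rewrite -[RHS]mem_enum -(mem_sort (relpre key leq)) -/s.
  apply/imsetP/idP => [[i _ ->]|]; first by rewrite ffunE mem_tnth.
  by move=> /(tnthP t)[i ->]; exists i; rewrite ?ffunE.
apply/forallP => i; apply/forallP => j; rewrite !ffunE.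
apply/implyP => _; apply/implyP => H.
have kij : (key (tnth t i) < key (tnth t j))%N.
  by case/orP: H => /andP[/eqP + h]; rewrite /key => ->;
    rewrite ?ltn_add2l ?ltn_add2r.
rewrite ltnNge; apply/negP => ji; move: kij; rewrite ltnNge => /negP; apply.
have x0 := tnth t i; rewrite !(tnth_nth x0).
have := sorted_leq_nth _ _ x0 sorts; apply => //.
- by move=> a b c /=; exact: leq_trans.
- by move=> a /=; exact: leqnn.
- by rewrite inE ss.
- by rewrite inE ss.
Qed.

Hypothesis d_neq0 : d%:R != 0 :> K.
Variable xi : 'I_d -> K.
Hypotheses (xi_inj : injective xi) (xi_root : forall k, xi k ^+ d = 1).
Variable rho : forall mu : dpart d n, YH q d n -> 'M[K]_#|{: stdtab mu}|.
Hypothesis rhoP : forall mu, seminormal_rep xi (rho mu).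

(** The content of entry 0 is 1 because its box is the corner of a
    component. *)
Lemma diag_rep_jucys_murphy mu (i : 'I_n) :
  diag_rep (rho mu) (jucys_murphy i) (fun T => quantum_content q (T i)).
Proof.
case: i => m; elim: m => [|m IH] mn.
  move=> T; rewrite (rep_one (rhoP mu)) mul1mx.
  have n0 : (0 < n)%N by [].
  have C0 : q ^+ (2 * n.-1) != 0 by rewrite expf_neq0.
  suff -> : quantum_content q (T (Ordinal mn)) = 1 by rewrite scale1r.
  apply: (mulfI C0); rewrite -(letter_param_content q_neq0) [take _ _]take0.
  rewrite letter_paramE /box_param mulr1 add0n.
  have := lattice_dominant (lattice_take 1 (lattice_tab_word (stdtabP T))).
  rewrite (take_nth (letter_at T (Ordinal mn))) ?size_tab_word //.
  rewrite (nth_codom_ord _ _ (Ordinal mn)) take0.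
  move: (letter_at T _) => -[k r] /dominantP/(_ k (Ordinal n0) r (leq0n _)) /=.
  rewrite eqxx !addn0; case: eqP => // -[->] _.
  by rewrite /= subn0.
have m1 : (m < n.-1)%N by rewrite ltn_predRL.
rewrite /= insubT; pose i : 'I_n.-1 := Ordinal m1.
have mE : slo i = Ordinal (ltnW mn) by exact/val_inj.
have SmE : Ordinal mn = shi i by exact/val_inj.
rewrite SmE; apply: (diag_rep_content_step q_neq0 q_gen d_neq0 xi_root
  (rhoP mu)).
by rewrite mE; exact: IH.
Qed.

Local Notation path := {mu : dpart d n & stdtab mu}.

(** The element x acts on all tableau bases at once as a diagonal matrix,
    with the eigenvalue c p on the tableau p. *)
Definition separator (x : YH q d n) (c : path -> K) : Prop :=
  forall mu, diag_rep (rho mu) x (fun T => c (Tagged _ T)).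

(** Two tableaux, possibly of different shapes, differ in the position or in
    the content of some entry; an affine function of t_i or of a
    Jucys--Murphy element has the required eigenvalues. *)
Lemma separate_pair (p p0 : path) : p != p0 ->
  exists x c, [/\ separator x c, c p = 0 & c p0 = 1].
Proof.
move=> pp0.
have aff x c : separator x c -> c p != c p0 ->
    exists x c, [/\ separator x c, c p = 0 & c p0 = 1].
  move=> xc cp; have cn : c p0 - c p != 0 by rewrite subr_eq0 eq_sym.
  exists ((c p0 - c p)^-1 *: (x + (- c p) *: 1)),
    (fun r => (c p0 - c p)^-1 * (c r + (- c p) * 1)); split.
  - move=> mu; apply: (diag_repZ (rhoP mu));
    apply: (diag_repD (rhoP mu)) (xc mu) _.
    exact/(diag_repZ (rhoP mu))/(diag_rep1 (rhoP mu)).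
  - by rewrite mulr1 subrr mulr0.
  - by rewrite mulr1 mulVf.
have tc i : separator (yh_t q d i) (fun r => xi (node_pos (tagged r i))).
  by move=> mu; exact: diag_rep_t (rhoP mu) i.
have jc (i : 'I_n) : separator (jucys_murphy i)
  (fun r => quantum_content q (tagged r i)).
  by move=> mu; exact: diag_rep_jucys_murphy.
case: p p0 pp0 aff => [mu T] [mu0 T0] /= pp0 aff.
have [ex|] := boolP [exists i : 'I_n, (node_pos (T i) != node_pos (T0 i))
    || (quantum_content q (T i) != quantum_content q (T0 i))].
  have /existsP[i /orP[h|h]] := ex;
    [apply: (aff _ _ (tc i)) => /=|exact: (aff _ _ (jc i))].
  by rewrite (inj_eq xi_inj).
rewrite negb_exists => /forallP H.
have [i|i|muE TE] := stdtab_sep (stdtabP T) (stdtabP T0).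
- by have := H i; rewrite negb_or !negbK => /andP[/eqP].
- by have := H i; rewrite negb_or !negbK => /andP[_ /eqP].
- case/eqP: pp0; subst mu0; congr (Tagged _ _); exact/val_inj.
Qed.

Lemma separate_path (p0 : path) :
  exists x c, [/\ separator x c, c p0 = 1 & forall p, p != p0 -> c p = 0].
Proof.
have [x [c [xc c1 c0]]] : exists x c, [/\ separator x c, c p0 = 1
    & forall p, p \in enum (predC1 p0) -> c p = 0].
  have : all (predC1 p0) (enum (predC1 p0)) by apply/allP => p;
    rewrite mem_enum.
  elim: (enum _) => [_|p r IH /= /andP[pp0 /IH[x [c [xc c1 c0]]]]].
    by exists 1, (fun=> 1); split=> // mu; exact: (diag_rep1 (rhoP mu)).
  have [y [e [ye e0 e1]]] := separate_pair pp0.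
  exists (x * y), (fun r => c r * e r); split.
  - by move=> mu; exact: (diag_repM (rhoP mu)).
  - by rewrite c1 e1 mulr1.
  - move=> p'; rewrite inE => /orP[/eqP ->|/c0 ->]; first by rewrite e0 mulr0.
    by rewrite mul0r.
by exists x, c; split=> // p pp0; apply: c0; rewrite mem_enum.
Qed.

(** The element that separates one tableau of shape lam from all the others
    has trace 1 on V_lam and trace 0 on the other representations. *)
Lemma trace_combination_eq0 (kappa : dpart d n -> K) :
  (forall x, \sum_mu kappa mu * \tr (rho mu x) = 0) -> forall mu, kappa mu = 0.
Proof.
move=> H lam; have [T sT] := exists_stdtab lam.
pose p0 : path := Tagged _ (StdTab sT : stdtab lam).
have [x [c [xc c1 c0]]] := separate_path p0.
rewrite -[LHS]mulr1 -c1 -[RHS](H x).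
under [RHS]eq_bigr do rewrite (trace_diag_rep (xc _)) mulr_sumr.
rewrite (sig_big_dep (J := fun mu => {: stdtab mu} : finType) predT
  (fun _ => predT)
  (fun mu (U : stdtab mu) => kappa mu * c (Tagged (fun mu => stdtab mu) U))) /=.
rewrite (bigD1 p0) //= big1 ?addr0 // => -[mu U] /= pp0.
by rewrite c0 ?mulr0.
Qed.

End Separation.

(** * Normal words are reduced *)

Section Reduced.

Variable n : nat.
Implicit Types (w : 'S_n) (s : seq nat) (i m l : nat).

Definition inversions w : {set 'I_n * 'I_n} :=
  [set p : 'I_n * 'I_n | (p.1 < p.2)%N && (w p.2 < w p.1)%N].

(** Generators are indexed by natural numbers, so that words of smaller
    symmetric groups need no change of type. *)
Definition gen_perm i : 'S_n :=
  if insub i is Some j then simple_transp (j : 'I_n.-1) else 1%g.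

Definition nat_word_perm s : 'S_n := (\prod_(i <- s) gen_perm i)%g.

Lemma nat_word_permE (u : seq 'I_n.-1) :
  word_perm u = nat_word_perm (map val u).
Proof.
by rewrite /nat_word_perm big_map; apply: eq_bigr => i _;
  rewrite /gen_perm valK.
Qed.

Lemma nat_word_perm_rcons s i :
  nat_word_perm (rcons s i) = (nat_word_perm s * gen_perm i)%g.
Proof. by rewrite /nat_word_perm -cats1 big_cat big_seq1. Qed.

Lemma gen_permE i (x : 'I_n) : (i.+1 < n)%N ->
  gen_perm i x
  = (if x == i :> nat then i.+1
     else if x == i.+1 :> nat then i else nat_of_ord x) :> nat.
Proof.
move=> i1; have in1 : (i < n.-1)%N by rewrite ltn_predRL.
by rewrite /gen_perm insubT simple_transpE.
Qed.

(** Exchanging the values i and i + 1 changes the order of the values only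
    for the pair of places where they occur. *)
Lemma inversions_mul w i : (i.+1 < n)%N ->
  inversions (w * gen_perm i)%g
  \subset [pred p : 'I_n * 'I_n | (w p.1 == i :> nat) && (w p.2 == i.+1 :> nat)
                    || (p \in inversions w)].
Proof.
move=> i1; apply/subsetP => -[a b]; rewrite !inE /= !permM !gen_permE //.
by move=> /andP[-> /=]; do ![case: eqP => /=]; lia.
Qed.

Lemma card_inversions_mul w i : (i.+1 < n)%N ->
  (#|inversions (w * gen_perm i)%g| <= #|inversions w|.+1)%N.
Proof.
move=> i1; apply: (leq_trans (subset_leq_card (inversions_mul w i1))).
have i0 : (i < n)%N by exact: ltnW.
set p := ((w^-1)%g (Ordinal i0), (w^-1)%g (Ordinal i1)).
apply: (@leq_trans #|p |: inversions w|); last by rewrite cardsU1;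
  case: (_ \notin _).
apply/subset_leq_card/subsetP => -[a b];
  rewrite !inE /= => /orP[/andP[ai bi]|->]; last exact: orbT.
apply/orP; left; apply/eqP; congr pair; apply: (canRL (permK w));
  exact/val_inj/eqP.
Qed.

Lemma card_inversions_mulS w i (a b : 'I_n) : (i.+1 < n)%N ->
  w a = i :> nat -> w b = i.+1 :> nat -> (a < b)%N ->
  #|inversions (w * gen_perm i)%g| = #|inversions w|.+1.
Proof.
move=> i1 wa wb ab.
have -> : inversions (w * gen_perm i)%g = (a, b) |: inversions w.
  apply/setP => -[x y]; rewrite !inE /= !permM !gen_permE // xpair_eqE.
  have E c k (wc : w c = k :> nat) z : (w z == k :> nat) = (z == c :> nat).
    by rewrite -wc !val_eqE (inj_eq perm_inj).
  rewrite -!val_eqE /=; move: (E _ _ wa x) (E _ _ wa y) (E _ _ wb x)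
    (E _ _ wb y).
  by do ![case: eqP => ?]; lia.
by rewrite cardsU1 inE /= wa wb ab ltnNge leqnSn.
Qed.

Lemma card_inversions_word s : all (fun i => i.+1 < n)%N s ->
  (#|inversions (nat_word_perm s)| <= size s)%N.
Proof.
elim/last_ind: s => [_|s i IH].
  rewrite leqn0 cards_eq0; apply/eqP/setP => p;
    rewrite !inE /nat_word_perm big_nil.
  by rewrite !perm1; case: ltngtP.
rewrite all_rcons => /andP[i1 sn]; rewrite nat_word_perm_rcons size_rcons.
by rewrite (leq_trans (card_inversions_mul _ i1)) // ltnS IH.
Qed.

Lemma nat_word_perm_fix s (x : 'I_n) : all (fun i => i.+1 < x)%N s ->
  nat_word_perm s x = x.
Proof.
elim/last_ind: s => [_|s i IH]; first by rewrite /nat_word_perm big_nil perm1.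
rewrite all_rcons => /andP[ix sx]; rewrite nat_word_perm_rcons permM IH //.
apply/val_inj; rewrite /= gen_permE; last exact: ltn_trans ix (ltn_ord x).
by do ![case: eqP => ?]; lia.
Qed.

(** In a run, the next generator i exchanges the values i and i + 1. The
    value i + 1 is at place m, and the value i at an earlier place since the
    places after m are fixed; so one inversion is added. *)
Lemma normal_word_length m s : normal_word m s -> (m <= n)%N ->
  #|inversions (nat_word_perm s)| = size s.
Proof.
elim=> {m s} [_|m s l ns IH].
  by apply/eqP; rewrite -leqn0; exact: card_inversions_word.
elim: l => [|l IHl] lm mn.
  by rewrite (_ : down m 0 = [::]) // cats0 IH // ltnW.
have lm' := ltnW lm; rewrite down_rcons // -rcons_cat nat_word_perm_rcons
  size_rcons.
pose x := Ordinal mn; set w := nat_word_perm (s ++ down m l).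
have wx : w x = (m - l)%N :> nat.
  rewrite /w; elim: l lm' {lm IHl w} => [|l IHl] lm.
    rewrite (_ : down m 0 = [::]) // cats0 subn0 nat_word_perm_fix //.
    by have := normal_word_bound ns.
  rewrite down_rcons // -rcons_cat nat_word_perm_rcons permM gen_permE;
    last by lia.
  rewrite IHl 1?ltnW //.
  have -> : (m - l == m - l.+1)%N = false by lia.
  by have -> : (m - l == (m - l.+1).+1)%N by lia.
have i0 : (m - l.+1 < n)%N by lia.
pose a := (w^-1)%g (Ordinal i0).
have wa : w a = (m - l.+1)%N :> nat by rewrite permKV.
rewrite (@card_inversions_mulS _ _ a x) ?IHl //.
- by lia.
- by rewrite wx; lia.
rewrite ltnNge; apply/negP => xa; have [ax|ax] := eqVneq a x.
  by move: wa; rewrite ax wx; lia.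
have {xa ax} xa : (m < a)%N by move: ax; rewrite -val_eqE /= in xa *; lia.
have : w a = a.
  apply: nat_word_perm_fix; rewrite all_cat; apply/andP; split.
    by apply: sub_all (normal_word_bound ns) => k; lia.
  by apply/allP => k; rewrite mem_down //; lia.
by move=> /(congr1 val) /=; rewrite wa; lia.
Qed.

(** The number of inversions is a lower bound for the length of any word of
    a permutation, and normal words attain it. *)
Lemma normal_word_reduced (u : seq 'I_n.-1) : normal_word n (map val u) ->
  reduced_expression (word_perm u) u.
Proof.
move=> nu; split=> // u' E.
rewrite -(size_map val u) -(normal_word_length nu) // -nat_word_permE -E.
rewrite nat_word_permE -(size_map val u'); apply: card_inversions_word.
by apply/allP => _ /mapP[i _ ->] /=; rewrite -ltn_predRL.
Qed.

Lemma normal_word_perm_eq1 (u : seq 'I_n.-1) : normal_word n (map val u) ->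
  (word_perm u == 1%g) = (u == [::]).
Proof.
move=> nu; apply/eqP/eqP => [E|->]; last by rewrite /word_perm big_nil.
have [_ /(_ [::])] := normal_word_reduced nu; rewrite E /word_perm big_nil.
by move=> /(_ erefl) /=; rewrite leqn0 => /nilP.
Qed.

End Reduced.

(** * Monomials of normal words span the algebra *)

Section Spanning.

Variables (K : fieldType) (q : K) (d n : nat).
Hypothesis d_gt0 : (0 < d)%N.
Local Notation A := (YH q d n).
Implicit Types (x y e : A) (s : seq nat) (i j m l : nat).

Lemma malgU_scale (M : choiceType) (c : K) (k : M) :
  << c *g k >> = c *: << k >> :> {malg K[M]}.
Proof. by apply/malgP => k'; rewrite mcoeffZ !mcoeffU mulrnAr mulr1. Qed.

(** The algebra is a quotient of the free algebra, whose elements are linear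
    combinations of words in the generators. *)
Lemma yh_ind (P : A -> Prop) :
  P 1 -> (forall x y, P x -> P y -> P (x + y)) ->
  (forall c x, P x -> P (c *: x)) ->
  (forall x (i : 'I_n.-1), P x -> P (x * yh_g q d i)) ->
  (forall x (j : 'I_n), P x -> P (x * yh_t q d j)) ->
  forall x, P x.
Proof.
move=> P1 PD PZ Pg Pt x; have [r <-] : exists r, yh_pi q d r = x by eexists;
  exact: yh_pi_repr.
rewrite [r]monalgE.
have P0 : P 0 by rewrite -(scale0r 1); exact: PZ.
elim: (finmap.enum_fset (msupp r)) => [|k ks IH];
  first by rewrite big_nil yh_pi0.
rewrite big_cons yh_piD; apply: PD => //.
rewrite malgU_scale yh_pi_scale; apply: PZ.
case: k => s; elim/last_ind: s => [|s a IHs].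
  rewrite (_ : << _ >> = 1) ?yh_pi_one //.
  by congr (<< _ >>); apply/val_inj; rewrite /= fm1.
have -> : << {| fmonom_val := rcons s a |} >>
    = << {| fmonom_val := s |} >> * << fmu a >> :>
      {malg K[{fmonom ('I_n.-1 + 'I_n)%type}]}.
  rewrite malgM_def fgmulUU mulr1; congr (<< _ >>).
  by apply/val_inj; rewrite /= fmM fmU cats1.
rewrite yh_pi_mul; case: a => [i|j].
  have -> : << fmu (inl i) >> = free_g K i by rewrite /free_g -lock.
  exact: Pg.
have -> : << fmu (inr j) >> = free_t K j by rewrite /free_t -lock.
exact: Pt.
Qed.

Definition nat_g i : A := if insub i is Some j then yh_g q d j else 1.

Definition g_word s : A := \prod_(i <- s) nat_g i.

Lemma g_wordE (u : seq 'I_n.-1) :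
  \prod_(i <- u) yh_g q d i = g_word (map val u).
Proof. by rewrite /g_word big_map; apply: eq_bigr => i _; rewrite /nat_g valK.
Qed.

Lemma g_word_cat s1 s2 : g_word (s1 ++ s2) = g_word s1 * g_word s2.
Proof. exact: big_cat. Qed.

Lemma g_word1 i : g_word [:: i] = nat_g i.
Proof. exact: big_seq1. Qed.

Lemma g_word_rcons s i : g_word (rcons s i) = g_word s * nat_g i.
Proof. by rewrite -cats1 g_word_cat g_word1. Qed.

Lemma nat_gE i (i1 : (i < n.-1)%N) : nat_g i = yh_g q d (Ordinal i1).
Proof. by rewrite /nat_g insubT. Qed.

Lemma nat_g_comm i j : (i.+1 < j)%N -> nat_g i * nat_g j = nat_g j * nat_g i.
Proof.
move=> ij; have [jn|nj] := ltnP j n.-1; last first.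
  by rewrite [nat_g j]/nat_g insubF ?mul1r ?mulr1 // ltnNge nj.
have i1 : (i < n.-1)%N by lia.
by rewrite !nat_gE yh_gg //= ij.
Qed.

Lemma nat_g_braid i : (i.+2 < n)%N ->
  nat_g i * nat_g i.+1 * nat_g i = nat_g i.+1 * nat_g i * nat_g i.+1.
Proof.
move=> i2; have i1 : (i.+1 < n.-1)%N by rewrite ltn_predRL.
by rewrite (nat_gE i1) (nat_gE (ltnW i1)) yh_braid.
Qed.

(** The subalgebra generated by the t_j. *)
Inductive t_poly : A -> Prop :=
| TPoly1 : t_poly 1
| TPolyT (j : 'I_n) : t_poly (yh_t q d j)
| TPolyD e e' : t_poly e -> t_poly e' -> t_poly (e + e')
| TPolyM e e' : t_poly e -> t_poly e' -> t_poly (e * e')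
| TPolyZ c e : t_poly e -> t_poly (c *: e).

Lemma t_poly_e (i : 'I_n.-1) : t_poly (yh_e q d i).
Proof.
have X m x : t_poly x -> t_poly (x ^+ m).
  by move=> tx; elim: m => [|m IH]; [exact: TPoly1 | rewrite exprS;
    exact: TPolyM].
apply: TPolyZ; apply: big_ind => [||s _].
- by rewrite -(scale0r 1); apply: TPolyZ; exact: TPoly1.
- exact: TPolyD.
- by apply: TPolyM; apply: X; exact: TPolyT.
Qed.

(** The relation t_j g_i = g_i t_(s_i j) moves the t_j to the left of any
    product of the g_i. *)
Lemma t_poly_push s e : t_poly e ->
  exists2 e', t_poly e' & g_word s * e = e' * g_word s.
Proof.
elim/last_ind: s e => [|s i IH] e te.
  by exists e; rewrite // /g_word big_nil mul1r mulr1.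
have [e1 te1 E1] : exists2 e', t_poly e' & nat_g i * e = e' * nat_g i.
  rewrite /nat_g; case: insubP => [k _ _|_]; last by exists e;
    rewrite // mul1r mulr1.
  elim: te => [|j|x y _ [x' tx xE] _ [y' ty yE]|x y _ [x' tx xE] _
    [y' ty yE]|c x _ [x' tx xE]].
  - by exists 1; [exact: TPoly1 | rewrite mul1r mulr1].
  - exists (yh_t q d (simple_transp k j)); first exact: TPolyT.
    by rewrite yh_tg tpermK.
  - by exists (x' + y'); [exact: TPolyD | rewrite mulrDr mulrDl xE yE].
  - by exists (x' * y'); [exact: TPolyM | rewrite mulrA xE -mulrA yE mulrA].
  - by exists (c *: x'); [exact: TPolyZ | rewrite -scalerAr xE scalerAl].
have [e2 te2 E2] := IH _ te1.
by exists e2; rewrite // g_word_rcons -mulrA E1 mulrA E2 mulrA.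
Qed.

Inductive normal_span m : A -> Prop :=
| NSpan e s : t_poly e -> normal_word m s -> normal_span m (e * g_word s)
| NSpanD x y : normal_span m x -> normal_span m y -> normal_span m (x + y).

Lemma normal_span_tl m e x : t_poly e -> normal_span m x ->
  normal_span m (e * x).
Proof.
move=> te; elim=> [e' s te' ns|y z _ IHy _ IHz].
  by rewrite mulrA; apply: NSpan => //; exact: TPolyM.
by rewrite mulrDr; exact: NSpanD.
Qed.

Lemma normal_spanZ m c x : normal_span m x -> normal_span m (c *: x).
Proof.
move=> sx; rewrite -[x]mul1r scalerAl; apply: normal_span_tl => //.
exact/TPolyZ/TPoly1.
Qed.

Lemma normal_span_tr m e x : t_poly e -> normal_span m x ->
  normal_span m (x * e).
Proof.
move=> te; elim=> [e' s te' ns|y z _ IHy _ IHz].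
  have [e1 te1 E1] := t_poly_push s te.
  by rewrite -mulrA E1 mulrA; apply: NSpan => //; exact: TPolyM.
by rewrite mulrDl; exact: NSpanD.
Qed.

Lemma normal_span_down m l x : (l <= m)%N -> normal_span m x ->
  normal_span m.+1 (x * g_word (down m l)).
Proof.
move=> lm; elim=> [e s te ns|y z _ IHy _ IHz].
  by rewrite -mulrA -g_word_cat; apply: NSpan => //; exact: NormalWordS.
by rewrite mulrDl; exact: NSpanD.
Qed.

Lemma down_comm m l i : (l <= m)%N -> (i.+1 < m - l)%N ->
  g_word (down m l) * nat_g i = nat_g i * g_word (down m l).
Proof.
elim: l => [|l IH] lm il; first by rewrite /g_word big_nil mul1r mulr1.
rewrite down_rcons // g_word_rcons -mulrA -nat_g_comm //.
by rewrite !mulrA IH //; lia.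
Qed.

(** The generator i moves to the left through the smaller generators of the
    run, becomes i - 1 by the braid relation when it meets i and i - 1, and
    then moves through the larger ones. *)
Lemma down_braid m l i : (m < n)%N -> (l <= m)%N -> (m - l < i < m)%N ->
  g_word (down m l) * nat_g i = nat_g i.-1 * g_word (down m l).
Proof.
move=> mn; elim: l => [|l IH] lm il; first by lia.
have [iE|il'] := eqVneq i (m - l)%N; last first.
  rewrite down_rcons // g_word_rcons -mulrA nat_g_comm; last by lia.
  by rewrite !mulrA IH //; lia.
case: l IH lm il iE => [|l] _ lm il iE; first by lia.
rewrite down_rcons // [down m l.+1]down_rcons 1?ltnW // !g_word_rcons -iE.
have iE' : (m - l.+2 = i.-1)%N by lia.
rewrite iE' -!mulrA.
have := @nat_g_braid i.-1; rewrite prednK; last by lia.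
rewrite -!mulrA => <-; last by lia.
by rewrite mulrA down_comm ?mulrA //; lia.
Qed.

Lemma nat_g_quad i : (i.+1 < n)%N -> exists2 e, t_poly e &
  nat_g i * nat_g i = 1 + e * nat_g i.
Proof.
move=> i1; have in1 : (i < n.-1)%N by rewrite ltn_predRL.
exists ((q - q^-1) *: yh_e q d (Ordinal in1)); first exact/TPolyZ/t_poly_e.
by rewrite (nat_gE in1) -expr2 yh_gquad scalerAl.
Qed.

(** The span is a left module over the t_j, so it suffices to multiply a
    normal word by a generator i. Either i passes through the last run,
    possibly as i - 1, and the induction hypothesis applies to the rest of
    the word; or i extends the last run; or i is the last letter of the run
    and the quadratic relation removes the square. *)
Lemma normal_span_g m i x : (m <= n)%N -> (i.+1 < m)%N -> normal_span m x ->
  normal_span m (x * nat_g i).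
Proof.
elim: m i x => [//|m IH] i x mn im; elim=> [e s te ns|y z _ IHy _ IHz];
  last first.
  by rewrite mulrDl; exact: NSpanD.
rewrite -mulrA; apply: normal_span_tl te _ => {e}.
move: im; rewrite ltnS => im.
inversion ns as [|m' s' l ns' lm mE sE]; subst m' s; clear ns.
have s'span : normal_span m (g_word s').
  by rewrite -[g_word s']mul1r; apply: NSpan => //; exact: TPoly1.
rewrite g_word_cat -mulrA.
(* The generator i commutes with the whole run. *)
have [il|il] := ltnP i.+1 (m - l).
  rewrite down_comm // mulrA; apply: normal_span_down => //.
  by apply: IH => //; [exact: ltnW | lia].
(* The generator i extends the run. *)
have [il1|il1] := eqVneq i.+1 (m - l)%N.
  have lm' : (l < m)%N by lia.
  rewrite -g_word_rcons (_ : i = m - l.+1)%N; last by lia.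
  by rewrite -down_rcons //; apply: normal_span_down.
(* The generator i passes through the run and becomes i - 1. *)
have [il2|il2] := eqVneq i (m - l)%N; last first.
  rewrite down_braid //; last by lia.
  rewrite mulrA; apply: normal_span_down => //.
  by apply: IH => //; [exact: ltnW | lia].
case: l lm il il1 il2 {IH} => [|l] lm il il1 il2; first by lia.
rewrite down_rcons // g_word_rcons -il2.
(* The generator i is the last letter of the run. *)
have [e te eE] : exists2 e, t_poly e & nat_g i * nat_g i = 1 + e * nat_g i.
  by apply: nat_g_quad; lia.
rewrite -mulrA eE mulrDr mulr1 mulrDr; apply: NSpanD.
  by apply: normal_span_down => //; exact: ltnW.
rewrite mulrA mulrA -g_word_cat.
have [e' te' ->] := t_poly_push (s' ++ down m l) te.
rewrite -mulrA -g_word_rcons rcons_cat il2 -down_rcons //.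
by apply: NSpan => //; exact: NormalWordS.
Qed.

Lemma normal_word_nil m : normal_word m [::].
Proof.
by elim: m => [|m IH]; [exact: NormalWord0 | exact: (NormalWordS (l := 0) IH)].
Qed.

Lemma normal_span_all x : normal_span n x.
Proof.
elim/yh_ind: x => [|x y|c x|x i sx|x j sx].
- rewrite -[1]mulr1 (_ : 1 = g_word [::] :> A); last by rewrite /g_word big_nil.
  by rewrite {1}/g_word big_nil; apply: NSpan;
    [exact: TPoly1 | exact: normal_word_nil].
- exact: NSpanD.
- exact: normal_spanZ.
- have -> : yh_g q d i = nat_g i by rewrite /nat_g valK.
  by apply: normal_span_g => //; rewrite -ltn_predRL.
- exact/normal_span_tr/sx/TPolyT.
Qed.

Inductive monomial_span : A -> Prop :=
| MSpan (k : 'I_n -> 'I_d) (u : seq 'I_n.-1) : normal_word n (map val u) ->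
    monomial_span (yh_monomial q k u)
| MSpanD x y : monomial_span x -> monomial_span y -> monomial_span (x + y)
| MSpanZ c x : monomial_span x -> monomial_span (c *: x).

Lemma t_mul_prod (j : 'I_n) (k : 'I_n -> 'I_d) (r : seq 'I_n) : uniq r ->
  j \in r ->
  yh_t q d j * \prod_(i <- r) yh_t q d i ^+ k i
  = \prod_(i <- r) yh_t q d i ^+ (if i == j then (k i).+1 %% d else k i)%N.
Proof.
elim: r => [//|i r IH] /= /andP[ir ur]; rewrite inE !big_cons.
case: (eqVneq j i) ir => [<- ir _|ji ir /= jr].
  rewrite mulrA -exprS (expr_mod _ (yh_td _ _ _)); congr (_ * _).
  rewrite !big_seq; apply: eq_bigr => k' k'r.
  by rewrite ifN //; apply: contraNneq ir => <-.
by rewrite -IH // !mulrA (commrX _ (yh_tt _ _ _ _)).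
Qed.

Lemma monomial_span_t e x : t_poly e -> monomial_span x ->
  monomial_span (e * x).
Proof.
move=> te; elim: te x => [|j|e1 e2 _ IH1 _ IH2|e1 e2 _ IH1 _ IH2|c e1 _ IH] x
  sx.
- by rewrite mul1r.
- elim: sx => [k u nu|y z _ IHy _ IHz|c y _ IHy].
  + rewrite /yh_monomial mulrA t_mul_prod ?index_enum_uniq ?mem_index_enum //.
    pose k' (i : 'I_n) := if i == j then Ordinal (ltn_pmod (k i).+1 d_gt0)
      else k i.
    rewrite (eq_bigr (fun i : 'I_n => yh_t q d i ^+ k' i));
      first exact: (MSpan k').
    by move=> i _; rewrite /k'; case: ifP.
  + by rewrite mulrDr; exact: MSpanD.
  + by rewrite -scalerAr; exact: MSpanZ.
- by rewrite mulrDl; apply: MSpanD; [exact: IH1 | exact: IH2].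
- by rewrite -mulrA; apply/IH1/IH2.
- by rewrite -scalerAl; apply/MSpanZ/IH.
Qed.

Lemma monomial_span_all x : monomial_span x.
Proof.
elim: (normal_span_all x) => [e s te ns|y z _ IHy _ IHz]; last exact: MSpanD.
apply: monomial_span_t te _.
have [u sE] : exists u : seq 'I_n.-1, s = map val u.
  exists (pmap insub s); rewrite (pmap_filter (insubK _)).
  apply/esym/all_filterP/allP => i /(allP (normal_word_bound ns)) i1.
  by rewrite insubT // ltn_predRL.
have := @MSpan (fun=> Ordinal d_gt0) u; rewrite -sE => /(_ ns).
by rewrite /yh_monomial big1 ?mul1r ?g_wordE -?sE.
Qed.

End Spanning.

(** * Power sums of roots of unity *)

Section RootsOfUnity.

Variables (K : fieldType) (d : nat) (xi : 'I_d -> K).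
Hypotheses (xi_inj : injective xi) (xi_root : forall k, xi k ^+ d = 1).

(** Multiplication by a d-th root of unity z permutes the d-th roots of
    unity, so it multiplies the sum of their j-th powers by z^j as well as
    by 1. *)
Lemma sum_unity_root_powers j : (j < d)%N ->
  \sum_k xi k ^+ j = d%:R *+ (j == 0%N).
Proof.
case: j => [_|j jd].
  by rewrite (eq_bigr (fun=> 1)) => [|k _];
    rewrite ?expr0 // sumr_const card_ord.
have ux : uniq (codom xi) by apply/injectiveP.
have sx : size (codom xi) = d by rewrite size_codom card_ord.
have d0 : (0 < d)%N by exact: leq_trans jd.
(* The polynomial X^(j + 1) - 1 has fewer than d roots. *)
have [k0 k0j] : exists k, xi k ^+ j.+1 != 1.
  apply/existsP; apply: contraLR jd; rewrite negb_exists -leqNgt => /forallP H.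
  rewrite -sx; apply: max_unity_roots => //; apply/allP => _ /codomP[k ->].
  by have := H k; rewrite negbK unity_rootE.
have rootsE z : z ^+ d = 1 -> z \in codom xi.
  move=> zd; apply/negPn/negP => zx.
  have := @max_unity_roots _ d (z :: codom xi) d0.
  rewrite /= zx ux sx ltnn => H; suff : false by [].
  apply: H => //; rewrite unity_rootE zd eqxx /=.
  by apply/allP => _ /codomP[k ->]; rewrite unity_rootE xi_root.
have xk0 : xi k0 != 0.
  apply/eqP => x0; have /eqP := xi_root k0.
  by rewrite x0 expr0n eqn0Ngt d0 eq_sym oner_eq0.
have um : uniq [seq xi k0 * z | z <- codom xi].
  by rewrite map_inj_uniq //; exact: mulfI.
have [||_ mE] := @uniq_min_size _ [seq xi k0 * z | z <- codom xi] (codom xi) um.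
- move=> _ /mapP[_ /codomP[k ->] ->].
  by apply: rootsE; rewrite exprMn !xi_root mulr1.
- by rewrite (size_map _ (codom xi)) leqnn.
have E : \sum_(z <- [seq xi k0 * z | z <- codom xi]) z ^+ j.+1
    = \sum_(z <- codom xi) z ^+ j.+1 by apply: perm_big; exact: uniq_perm.
rewrite codomE !big_map -!enumT !big_enum in E.
have {E} : (xi k0 ^+ j.+1 - 1) * \sum_k xi k ^+ j.+1 = 0.
  rewrite mulrBl mul1r -[X in _ - X]E mulr_sumr; apply/eqP; rewrite subr_eq0;
    apply/eqP.
  by apply: eq_bigr => k _; rewrite exprMn.
by move=> /eqP; rewrite mulf_eq0 subr_eq0 (negPf k0j) /= => /eqP ->;
  rewrite mulr0n.
Qed.

End RootsOfUnity.

(** * The canonical form as a combination of characters *)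

Section SchurElements.

Variables (K : fieldType) (q : K) (d n : nat).
Hypotheses (q_neq0 : q != 0) (q_gen : forall m, (0 < m)%N -> q ^+ m != 1).
Hypotheses (d_gt0 : (0 < d)%N) (d_neq0 : d%:R != 0 :> K).
Variable xi : 'I_d -> K.
Hypotheses (xi_inj : injective xi) (xi_root : forall k, xi k ^+ d = 1).
Variable rho : forall mu : dpart d n, YH q d n -> 'M[K]_#|{: stdtab mu}|.
Hypothesis rhoP : forall mu, seminormal_rep xi (rho mu).
Local Notation letter := ('I_d * 'I_n)%type.

(** The inverse of the Schur element of lam, as computed along paths. *)
Definition shape_weight (lam : dpart d n) : K :=
  d%:R ^- n * \prod_(k < d) part_weight q (part lam k).

Lemma path_weight_tab_word lam T : is_stdtab lam T ->
  path_weight q (tab_word T) = shape_weight lam.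
Proof.
move=> sT; rewrite (path_weight_lattice q_neq0 q_gen (lattice_tab_word sT)).
rewrite size_tab_word; congr (_ * _); apply: eq_bigr => k _.
by rewrite (row_counts_tab_word sT).
Qed.

(** Words that are not lattice have weight 0, the others are those of the
    standard tableaux. *)
Lemma sum_path_weight (G : seq letter -> K) :
  \sum_(w <- words d n n) path_weight q w * G w
  = \sum_mu shape_weight mu * \sum_(T : stdtab mu) G (tab_word T).
Proof.
rewrite (bigID (@lattice d n)) /= [X in _ + X]big1 ?addr0; last first.
  by move=> w lw; rewrite path_weight_eq0 ?mul0r.
under [RHS]eq_bigr do rewrite mulr_sumr.
rewrite (sig_big_dep (J := fun mu => {: stdtab mu} : finType) predT
  (fun _ => predT)
  (fun mu (U : stdtab mu) => shape_weight mu * G (tab_word U))) /=.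
pose F w := path_weight q w * G w.
pose wd (p : {mu : dpart d n & stdtab mu}) := tab_word (tagged p).
transitivity (\sum_(p : {mu : dpart d n & stdtab mu}) F (wd p)); last first.
  by apply: eq_bigr => -[mu T] _; rewrite /F (path_weight_tab_word (stdtabP T)).
rewrite -big_enum -(big_map wd predT F) -big_filter; apply: perm_big.
apply: uniq_perm; rewrite ?filter_uniq ?uniq_words //.
  rewrite map_inj_uniq ?enum_uniq // => -[mu T] [nu U] /= E.
  have [muE TE] := tab_word_inj (stdtabP T) (stdtabP U) E.
  by subst nu; congr (Tagged _ _); exact/val_inj.
move=> w; rewrite mem_filter mem_words;
  apply/andP/mapP => [[lw /eqP sw]|[[mu T] _ ->]].
  have [mu [T [sT TE]]] := standard_of_lattice lw sw.
  by exists (Tagged (fun mu => stdtab mu) (StdTab sT : stdtab mu));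
    rewrite ?mem_enum.
by rewrite (lattice_tab_word (stdtabP T)) size_tab_word.
Qed.

Lemma t_weight_tab_word (k : 'I_n -> 'I_d) (T : {ffun 'I_n -> dnode d n}) :
  t_weight xi (fun i => if insub i is Some j then k j : nat else 0%N)
    (tab_word T)
  = \prod_(j < n) xi (node_pos (T j)) ^+ k j.
Proof.
rewrite /t_weight size_tab_word -val_enum_ord /tab_word codomE zip_map.
by rewrite big_map big_enum; apply: eq_bigr => j _; rewrite /= valK.
Qed.

Lemma weighted_trace_monomial (k : 'I_n -> 'I_d) (u : seq 'I_n.-1) :
  normal_word n (map val u) ->
  \sum_mu shape_weight mu * \tr (rho mu (yh_monomial q k u))
  = ((u == [::]) && [forall j, k j == 0%N :> nat])%:R.
Proof.
move=> nu; under eq_bigr do rewrite (trace_monomial q_neq0 (rhoP _)).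
pose kn i := if insub i is Some j then k j : nat else 0%N.
pose G (w : seq letter) := t_weight xi kn w * coef q (map val u) w w.
transitivity (\sum_mu shape_weight mu * \sum_(T : stdtab mu) G (tab_word T)).
  apply: eq_bigr => mu _; congr (_ * _); apply: eq_bigr => T _.
  by rewrite /G t_weight_tab_word.
rewrite -sum_path_weight.
have := word_trace_normal q_neq0 q_gen d_neq0
  (sum_unity_root_powers xi_inj xi_root)
  (k := kn) nu (leqnn n).
rewrite /word_trace => H; under eq_bigr do rewrite mulrA; rewrite H.
  congr ((nat_of_bool (_ && _))%:R); first by case: (u).
  apply/allP/forallP => [h j|h i].
    by have := h j; rewrite mem_iota ltn_ord /kn valK; apply.
  by rewrite mem_iota add0n /kn => ilt; rewrite insubT; exact: h.
by move=> i; rewrite /kn; case: insub.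
Qed.

Variable tau : {scalar YH q d n}.
Hypothesis tauP : canonical_trace_form tau.

(** Both sides agree on the monomials of normal words, which span the
    algebra. *)
Lemma canonical_trace_formE x :
  tau x = \sum_mu shape_weight mu * \tr (rho mu x).
Proof.
elim: (monomial_span_all d_gt0 x) => [k u nu|y z _ IHy _ IHz|c y _ IHy].
- rewrite weighted_trace_monomial // (tauP _ (normal_word_reduced nu)).
  by rewrite normal_word_perm_eq1 // andbC.
- rewrite linearD IHy IHz -big_split; apply: eq_bigr => mu _ /=.
  by rewrite (rep_add (rhoP mu)) mxtraceD mulrDr.
- rewrite linearZ /= IHy mulr_sumr; apply: eq_bigr => mu _.
  by rewrite (rep_scale (rhoP mu)) mxtraceZ mulrCA.
Qed.

Lemma schur_element_weight (s : dpart d n -> K) :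
  (forall x, tau x = \sum_mu (s mu)^-1 * \tr (rho mu x)) ->
  forall mu, s mu = (shape_weight mu)^-1.
Proof.
move=> sE mu; rewrite -[LHS]invrK; congr _^-1; apply/eqP; rewrite -subr_eq0;
  apply/eqP.
apply: (trace_combination_eq0 q_neq0 q_gen d_neq0 xi_inj xi_root rhoP
  (kappa := fun mu => (s mu)^-1 - shape_weight mu)) => x.
under eq_bigr do rewrite mulrBl.
by rewrite sumrB -sE -canonical_trace_formE subrr.
Qed.

Lemma shape_weight_inv lam :
  (shape_weight lam)^-1
  = d%:R ^+ n * q ^- (2 * eta lam) * \prod_(th in nodes lam) qint q
    (hook_length lam th).
Proof.
rewrite /shape_weight invfM invrK -mulrA; congr (_ * _).
rewrite -prodfV big_nodes /eta big_distrr /= -prodrXr -prodfV -big_split.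
apply: eq_bigr => k _ /=; rewrite /part_weight invfM invrK size_part;
  congr (_ * _).
apply: eq_bigr => r _; rewrite
  (big_ord_widen n (fun c => qint q (hook (part lam k) r c))) //.
exact: part_le.
Qed.

End SchurElements.

(** * The field of rational functions *)

Section RationalFunctions.

Variable R : realType.

Lemma tofrac_neq0 (p : {poly R[i]}) : p != 0 -> tofrac p != 0 :> Cq R.
Proof. by rewrite -tofrac0 tofrac_eq. Qed.

Lemma qvar_neq0 : qvar R != 0.
Proof. by rewrite tofrac_neq0 // polyX_eq0. Qed.

Lemma qvar_gen m : (0 < m)%N -> qvar R ^+ m != 1.
Proof.
move=> m0; rewrite /qvar -tofracXn -tofrac1 tofrac_eq.
by apply/eqP => /(congr1 (fun p : {poly R[i]} => size p));
  rewrite size_polyXn size_poly1; lia.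
Qed.

Lemma Cq_natr_neq0 d : (0 < d)%N -> d%:R != 0 :> Cq R.
Proof.
move=> d0; rewrite -tofrac0 -[d%:R](rmorph_nat (@tofrac {poly R[i]})) tofrac_eq.
by rewrite -polyC_natr polyC_eq0 Num.Theory.pnatr_eq0 -lt0n.
Qed.

Lemma Cq_const_inj : injective (@Cq_const R).
Proof. by move=> a b /eqP; rewrite tofrac_eq => /eqP/polyC_inj. Qed.

Lemma Cq_const_root d (a : R[i]) : d.-unity_root a -> Cq_const a ^+ d = 1.
Proof.
by move=> /unity_rootP ad; rewrite /Cq_const -tofracXn -polyC_exp ad tofrac1.
Qed.

End RationalFunctions.

Theorem proposition11 (R : realType) (d n : nat) (d_ge1 : (1 <= d)%N)
  (n_ge1 : (1 <= n)%N)
  (xi : 'I_d -> R[i]) (xi_inj : injective xi)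
  (xi_root : forall k, d.-unity_root (xi k))
  (rho : forall mu : dpart d n, CqYH R d n -> 'M[Cq R]_#|{: stdtab mu}|)
  (rhoP : forall mu, seminormal_rep (fun k => Cq_const (xi k)) (rho mu))
  (tau : {scalar CqYH R d n}) (tauP : canonical_trace_form tau)
  (s : dpart d n -> Cq R) (sP : schur_elements tau rho s)
  (lam : dpart d n) :
  s lam = d%:R ^+ n * qvar R ^- (2 * eta lam)
          * \prod_(th in nodes lam) qint (qvar R) (hook_length lam th).
Proof.
have cinj : injective (fun k => Cq_const (xi k)).
  by move=> j k /Cq_const_inj/xi_inj.
have croot k : Cq_const (xi k) ^+ d = 1 by exact: Cq_const_root.
case: sP => _ _ sE; rewrite -shape_weight_inv.
exact: (schur_element_weight (@qvar_neq0 R) (@qvar_gen R) d_ge1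
  (Cq_natr_neq0 R d_ge1) cinj croot rhoP tauP sE).
Qed.
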